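(* Let $p\in[1,\infty)$, let $q\in(1,\infty]$ satisfy $p^{-1}+q^{-1}=1$, and let $E$ be a separable real Banach space. Let $F\colon I\times E\multimap E$ be a set-valued map such that: (H1) the set $F(t,x)$ is nonempty, closed and bounded for every $(t,x)\in I\times E$; (H2) the map $F(\cdot,x)$ is $\Sigma$-measurable for every $x\in E$; (H3) there exists $\alpha\in L^p(I,\mathbb{R})$ such that $d_H(F(t,x),F(t,y))\leqslant\alpha(t)|x-y|$ for all $x,y\in E$, a.e. in $I$; (H4) there exists $\beta\in L^p(I,\mathbb{R})$ such that $d(0,F(t,0))\leqslant\beta(t)$ a.e. in $I$. Let $k\colon\triangle\to\mathcal{L}(E)$ be such that: (k5) $k(t,\cdot)\in L^q([0,t],\mathcal{L}(E))$ for every $t\in I$; (k6) the function $I\ni t\mapsto k(t,\cdot)\in L^q([0,t],\mathcal{L}(E))$ is continuous in the norm $\|\cdot\|_q$ of the space $L^q(I,\mathcal{L}(E))$. Then the solution set map $S_F^p\colon C(I,E)\multimap C(I,E)$, which assigns to each $h\in C(I,E)$ the set of all solutions of $$x(t)\in h(t)+\int_0^tk(t,s)F(s,x(s))\,ds,\quad t\in I,$$ possesses a continuous selection, i.e. there is a continuous function $f\colon C(I,E)\to C(I,E)$ such that $f(h)\in S_F^p(h)$ for every $h\in C(I,E)$.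
   Context: $I=[0,T]$, $\triangle=\{(t,s)\in I\times I\colon 0\leqslant s\leqslant t\leqslant T\}$, $\Sigma$ is the $\sigma$-algebra of Lebesgue measurable subsets of $I$. $E$ has norm $|\cdot|$; $\mathcal{L}(E)$ is the space of bounded linear endomorphisms of $E$ with the operator norm. $C(I,E)$ carries the maximum norm; $L^p(I,E)$ is the space of Bochner $p$-integrable maps. $d(x,A)=\inf\{|x-y|\colon y\in A\}$ and $d_H(A,B)=\max\{\sup_{x\in A}d(x,B),\sup_{y\in B}d(y,A)\}$ is the Hausdorff distance. A set-valued map $G\colon I\multimap E$ is $\Sigma$-measurable if $\{t\in I\colon G(t)\subset C\}\in\Sigma$ for every open $C\subset E$. In (k6), $k(t,\cdot)$ is regarded as an element of $L^q(I,\mathcal{L}(E))$ by extending it by $0$ outside $[0,t]$. A solution of the integral inclusion is a function $x\in C(I,E)$ such that $x(t)=h(t)+\int_0^tk(t,s)w(s)\,ds$ for all $t\in I$, for some $w\in L^p(I,E)$ with $w(t)\in F(t,x(t))$ for a.a. $t\in I$. *)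

(* Defs.v *)
From HB Require Import structures.
From mathcomp Require Import all_boot all_order all_algebra.
From mathcomp Require Import all_classical all_reals all_analysis.

Set Implicit Arguments.
Unset Strict Implicit.
Unset Printing Implicit Defensive.

Import Order.TTheory GRing.Theory Num.Theory.
Import numFieldNormedType.Exports.

Local Open Scope classical_set_scope.
Local Open Scope ring_scope.

Definition separable (X : topologicalType) : Prop :=
  exists2 D : set X, countable D & dense D.

Section BoundedEndo.
Context {R : realType} (E : normedModType R).

Definition is_bounded_endo : {pred E -> E} := fun f =>
  `[< linear f /\ exists M : R, forall x, `|f x| <= M * `|x| >].

Record bounded_endo := BoundedEndo {
  bendo :> E -> E ;
  bendoP : is_bounded_endo bendo }.

HB.instance Definition _ := [isSub for bendo].
HB.instance Definition _ := [Choice of bounded_endo by <:].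

Lemma is_bounded_endo_submod : submod_closed is_bounded_endo.
Proof.
split.
  apply/asboolP; split; first by move=> a u v /=; rewrite scaler0 addr0.
  by exists 0 => x /=; rewrite normr0 mul0r.
move=> a f g /asboolP[lf [M fM]] /asboolP[lg [N gN]]; apply/asboolP; split.
  move=> b u v; rewrite /= !fctE lf lg /= !scalerDr !scalerA (mulrC a b).
  by rewrite addrACA.
exists (`|a| * M + N) => x; rewrite !fctE (le_trans (ler_normD _ _))//.
by rewrite mulrDl lerD// normrZ -mulrA ler_wpM2l.
Qed.

HB.instance Definition _ :=
  GRing.isSubmodClosed.Build R (E -> E) is_bounded_endo is_bounded_endo_submod.
HB.instance Definition _ := [SubChoice_isSubLmodule of bounded_endo by <:].

Definition opnorm (f : bounded_endo) : R :=
  sup [set `|f x| | x in [set x : E | `|x| <= 1]].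

Lemma opnorm_has_sup (f : bounded_endo) :
  has_sup [set `|f x| | x in [set x : E | `|x| <= 1]].
Proof.
have /asboolP[_ [M fM]] := bendoP f; split.
  by exists (`|f 0|), 0 => //=; rewrite normr0.
exists `|M| => _ [x /= x1 <-]; rewrite (le_trans (fM x))//.
rewrite (le_trans (ler_norm _))// normrM normr_id.
by rewrite -[leRHS]mulr1 ler_wpM2l.
Qed.

Lemma opnorm_ub (f : bounded_endo) (x : E) : `|x| <= 1 -> `|f x| <= opnorm f.
Proof.
by move=> x1; apply: (ub_le_sup (opnorm_has_sup f).2); exists x.
Qed.

Lemma opnorm_le (f : bounded_endo) (M : R) :
  (forall x, `|x| <= 1 -> `|f x| <= M) -> opnorm f <= M.
Proof.
move=> fM; apply: ge_sup; first exact: (opnorm_has_sup f).1.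
by move=> _ [x /= x1 <-]; exact: fM.
Qed.

Lemma opnormD (f g : bounded_endo) : opnorm (f + g) <= opnorm f + opnorm g.
Proof.
apply: opnorm_le => x x1.
by rewrite (le_trans (ler_normD _ _))// lerD// opnorm_ub.
Qed.

Lemma opnorm_ge0 (f : bounded_endo) : 0 <= opnorm f.
Proof.
by rewrite (le_trans (normr_ge0 (f 0)))// opnorm_ub// normr0.
Qed.

Lemma opnormZ (a : R) (f : bounded_endo) : opnorm (a *: f) = `|a| * opnorm f.
Proof.
have le (b : R) (g : bounded_endo) : opnorm (b *: g) <= `|b| * opnorm g.
  by apply: opnorm_le => x x1; rewrite normrZ ler_wpM2l// opnorm_ub.
have [->|a0] := eqVneq a 0.
  apply/le_anti; rewrite normr0 mul0r opnorm_ge0 andbT.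
  by rewrite (le_trans (le _ _))// normr0 mul0r.
apply/le_anti; rewrite le/= -ler_pdivlMl ?normr_gt0// -normfV.
by rewrite -{1}(scale1r f) -(mulVf a0) -scalerA le.
Qed.

Lemma opnorm_eq0 (f : bounded_endo) : opnorm f = 0 -> f = 0.
Proof.
move=> f0; apply/val_inj/funext => x /=.
have /asboolP[lf _] := bendoP f.
have f00 : f 0 = 0.
  have := lf (-1) 0 0; rewrite scaler0 addr0 => ->.
  by rewrite scaleN1r addNr.
have [->//|x0] := eqVneq x 0.
have fZ a y : f (a *: y) = a *: f y by have := lf a y 0; rewrite !addr0 f00 addr0.
have nx : `|(`|x|)^-1 *: x| <= 1.
  by rewrite normrZ normfV normr_id mulVf// normr_eq0.
have := opnorm_ub f nx; rewrite f0 normr_le0 fZ scaler_eq0 invr_eq0 normr_eq0.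
by rewrite (negbTE x0) /= => /eqP.
Qed.

HB.instance Definition _ :=
  Lmodule_isNormed.Build R bounded_endo opnormD opnormZ opnorm_eq0.

End BoundedEndo.

Section MaxNorm.
Context {R : realType} (T : R) (E : normedModType R).

Local Notation I := (set_type (`[0, T]%classic : set R)).

Definition is_cts : {pred I -> E} := fun x => `[< continuous x >].

(* C([0, T], E), with the max norm below; the domain is the interval itself, as a subtype of R. *)
Record CI := MkCI { cfun :> I -> E ; cfunP : is_cts cfun }.

HB.instance Definition _ := [isSub for cfun].
HB.instance Definition _ := [Choice of CI by <:].

Lemma is_cts_submod : submod_closed is_cts.
Proof.
split; first by apply/asboolP; exact: (@cst_continuous I E 0).
move=> a f g /asboolP cf /asboolP cg; apply/asboolP => t.
exact: (cvgD (cvgZl_tmp (cf t)) (cg t)).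
Qed.

HB.instance Definition _ :=
  GRing.isSubmodClosed.Build R (I -> E) is_cts is_cts_submod.
HB.instance Definition _ := [SubChoice_isSubLmodule of CI by <:].

Definition maxnorm (x : CI) : R := sup [set `|x t| | t in [set: I]].

Lemma maxnorm_has_ub (x : CI) : has_ubound [set `|x t| | t in [set: I]].
Proof.
have /asboolP cx := cfunP x.
have {}cx := (subspace_valL_continuousP' _ (0 : E) x).2 cx.
have /compact_bounded/pinfty_ex_gt0[M _ xM] :=
  continuous_compact cx (@segment_compact R 0 T).
exists M => _ [t _ <-]; apply: xM => /=.
exists (\val t); first by have /set_mem := valP t.
exact: (congr1 (@^~ t) (valLK 0 (cfun x))).
Qed.

Lemma maxnorm_ub (x : CI) (t : I) : `|x t| <= maxnorm x.
Proof. by apply: (ub_le_sup (maxnorm_has_ub x)); exists t. Qed.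

Lemma maxnorm_le (x : CI) (M : R) :
  0 <= M -> (forall t, `|x t| <= M) -> maxnorm x <= M.
Proof.
move=> M0 xM; rewrite /maxnorm; have [->|/set0P ne] :=
  eqVneq [set `|x t| | t in [set: I]] set0; first by rewrite sup0.
by apply: ge_sup => // _ [t _ <-].
Qed.

Lemma maxnorm_ge0 (x : CI) : 0 <= maxnorm x.
Proof.
rewrite /maxnorm; have [->|/set0P[_ [t _ _]]] :=
  eqVneq [set `|x t| | t in [set: I]] set0; first by rewrite sup0.
exact: le_trans (normr_ge0 _) (maxnorm_ub x t).
Qed.

Lemma maxnormD (x y : CI) : maxnorm (x + y) <= maxnorm x + maxnorm y.
Proof.
apply: maxnorm_le => [|t]; first by rewrite addr_ge0 ?maxnorm_ge0.
by rewrite (le_trans (ler_normD _ _))// lerD// maxnorm_ub.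
Qed.

Lemma maxnormZ (a : R) (x : CI) : maxnorm (a *: x) = `|a| * maxnorm x.
Proof.
have le (b : R) (y : CI) : maxnorm (b *: y) <= `|b| * maxnorm y.
  apply: maxnorm_le => [|t]; first by rewrite mulr_ge0 ?maxnorm_ge0.
  by rewrite normrZ ler_wpM2l// maxnorm_ub.
have [->|a0] := eqVneq a 0.
  apply/le_anti; rewrite normr0 mul0r maxnorm_ge0 andbT.
  by rewrite (le_trans (le _ _))// normr0 mul0r.
apply/le_anti; rewrite le/= -ler_pdivlMl ?normr_gt0// -normfV.
by rewrite -{1}(scale1r x) -(mulVf a0) -scalerA le.
Qed.

Lemma maxnorm_eq0 (x : CI) : maxnorm x = 0 -> x = 0.
Proof.
move=> x0; apply/val_inj/funext => t /=; apply/eqP.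
by rewrite -normr_le0 -x0 maxnorm_ub.
Qed.

HB.instance Definition _ :=
  Lmodule_isNormed.Build R CI maxnormD maxnormZ maxnorm_eq0.

End MaxNorm.

(* The sigma-algebra of Lebesgue (not merely Borel) measurable subsets of R. *)
Notation lebesgueType R := (caratheodory_type ((@wlength R idfun)^*)%mu).

Section Bochner.
Context {R : realType} {V : normedModType R}.
Implicit Types (D : set R) (f s : R -> V) (p : \bar R).

Local Notation mu := (@completed_lebesgue_measure R).

Definition simple_on D s : Prop :=
  [/\ finite_set (s @` D),
      forall v, measurable (D `&` s @^-1` [set v] : set (lebesgueType R)) &
      forall v, v != 0 -> (mu (D `&` s @^-1` [set v]) < +oo)%E].

Definition simple_integral D s : V :=
  \sum_(v \in s @` D) fine (mu (D `&` s @^-1` [set v])) *: v.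

Definition strongly_measurable D f : Prop :=
  exists s_ : nat -> R -> V, (forall n, simple_on D (s_ n)) /\
    {ae mu, forall t, D t -> s_ n t @[n --> \oo] --> f t}.

(* Strong measurability is needed separately: on a non-measurable nonnegative
   integrand the library integral is a lower integral. *)
Definition is_bochner_integral D f (v : V) : Prop :=
  strongly_measurable D f /\
  exists s_ : nat -> R -> V,
    [/\ forall n, simple_on D (s_ n),
        (\int[mu]_(t in D) (`|f t - s_ n t|)%:E)%E @[n --> \oo] --> 0%E &
        simple_integral D (s_ n) @[n --> \oo] --> v].

Definition bochner_integral D f : V :=
  xget 0 [set v | is_bochner_integral D f v].

Definition Lp_norm p D f : \bar R :=
  ('N[mu]_p[EFin \o patch (fun=> 0%R) D (fun t => `|f t|%R)])%E.

Definition Lp_space p D : set (R -> V) :=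
  [set f | strongly_measurable D f /\ (Lp_norm p D f < +oo)%E].

End Bochner.

Section Hausdorff.
Context {R : realType} {E : normedModType R}.
Implicit Types A B : set E.

(* The real inf and sup below are the intended ones for nonempty bounded sets. *)
Definition set_dist (x : E) A : R := inf [set `|x - y| | y in A].

Definition hausdorff_dist A B : R :=
  Num.max (sup [set set_dist x B | x in A]) (sup [set set_dist y A | y in B]).

End Hausdorff.

Section Inclusion.
Context {R : realType} {E : normedModType R}.
Variable T : R.
Implicit Types (F : R -> E -> set E) (k : R -> R -> bounded_endo E).

Local Notation mu := (@completed_lebesgue_measure R).
Local Notation I := (`[0, T]%classic : set R).

Definition closed_bounded_values F : Prop := forall t x, I t ->
  [/\ F t x !=set0, closed (F t x) & bounded_set (F t x)].

Definition Sigma_measurable (G : R -> set E) : Prop := forall C, open C ->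
  measurable ([set t | I t /\ G t `<=` C] : set (lebesgueType R)).

(* The exceptional null set does not depend on x and y. *)
Definition hausdorff_lipschitz (p : R) F : Prop :=
  exists2 alpha : R -> R, Lp_space p%:E I alpha &
    {ae mu, forall t, I t -> forall x y,
      hausdorff_dist (F t x) (F t y) <= alpha t * `|x - y|}.

Definition dist0_bounded (p : R) F : Prop :=
  exists2 beta : R -> R, Lp_space p%:E I beta &
    {ae mu, forall t, I t -> set_dist 0 (F t 0) <= beta t}.

(* F t x is only used for t in I, and k t s only for 0 <= s <= t <= T. *)
Definition kernel_Lq (q : \bar R) k : Prop :=
  forall t, I t -> Lp_space q `[0, t]%classic (k t).

Definition kernel_ext k (t : R) : R -> bounded_endo E :=
  patch (fun=> 0) `[0, t] (k t).

(* Continuity of t |-> k(t, .) on I for the norm of L^q(I, L(E)). *)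
Definition kernel_continuous (q : \bar R) k : Prop := forall t, I t ->
  Lp_norm q I (fun s => kernel_ext k u s - kernel_ext k t s)
    @[u --> within I (nbhs t)] --> 0%E.

Definition solution_set (p : R) F k (h : CI T E) : set (CI T E) :=
  [set x | exists w : R -> E,
    [/\ Lp_space p%:E I w,
        {ae mu, forall s, forall t : I, \val t = s -> F s (x t) (w s)} &
        forall t : I, x t = h t +
          bochner_integral `[0, \val t] (fun s => k (\val t) s (w s))]].

End Inclusion.

(* Main.v *)
(* Start from a constant density and iterate w |-> (measurable approximate
   selection of F(t, x_w(t)) close to w), where x_w = h + int k w. Every density
   built takes values in a fixed dense sequence (e_j) of E, i.e. is given by a
   label nu(h, t) : nat, and the next label depends only on the current one and on
   a step function approximating x_w. The step function is the first one in a fixed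
   countable list whose uniform distance to x_w is below a threshold that depends
   on t; as h varies, that choice can jump at (h, t) only when the distance equals
   the threshold, i.e., for fixed h, for countably many t. Hence labels are
   locally constant in h for almost every t, and h |-> x_w is continuous by
   dominated convergence. Since distances to F(t, .) are compared pointwise in t,
   no decomposable selection theorem or Lyapunov convexity argument is needed.
   With Bielecki's exponential weight the iterates converge geometrically, locally
   uniformly in h, to a solution depending continuously on h. *)
Require Import Defs.
From mathcomp Require Import all_boot all_order all_algebra.
From mathcomp Require Import all_classical all_reals all_analysis.
From mathcomp Require Import measurable_realfun ess_sup_inf ring lra.

Set Implicit Arguments.
Unset Strict Implicit.
Unset Printing Implicit Defensive.

Import Order.TTheory GRing.Theory Num.Theory.
Import numFieldNormedType.Exports.

Local Open Scope classical_set_scope.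
Local Open Scope ring_scope.

(** All data are measured against the single function gamma = 1 + |alpha| + |beta| of L^p. It
    dominates the Lipschitz rate of F, the distance from 0 to F(t,0) and every constant, so bounds
    on densities take the form C * gamma. By Hoelder, apart from measurability of k(t,.), the kernel
    enters only through finiteness and continuity in t of the integrals of |k(t,s)| gamma(s); after
    that p = 1 and p > 1 are not distinguished. The threshold for the step function is eps (1 + t):
    being injective in t, it equals a given uniform distance at no more than one time, which makes
    the jump times countable. A threshold constant in t could make the label jump at all times at
    once. Values of F need not be convex or compact, so there may be no nearest point. The next
    density value is therefore required to be almost in F(t,x(t)) and almost as close to the current
    value as F(t,x(t)) permits. This gives Filippov's estimate |w' - w| <= d(w, F(t,x_w)) + error.
    The kernel factor 1/4 under the weight leaves room to absorb errors of size 2^-n gamma and still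
    halve the steps. *)

Lemma ge0_cvge0P {R : realType} {T : Type} (F : set_system T) {FF : Filter F}
    (u : T -> \bar R) : (forall x, (0 <= u x)%E) ->
  u @ F --> 0%E <-> forall e : R, 0 < e -> \forall x \near F, (u x < e%:E)%E.
Proof.
move=> u0; split=> [uF0 e e0|H].
  exact: (uF0 _ (@nbhs_open_ereal_lt _ 0 (fun=> e) e0)).
apply/fine_cvgP; split.
  apply: filterS (H 1 ltr01) => x ux1.
  by rewrite ge0_fin_numE// (lt_trans ux1)// ltry.
apply/cvgrPdist_lt => e e0; apply: filterS (H e e0) => x uxe.
rewrite sub0r normrN ger0_norm ?fine_ge0//= -lte_fin fineK//.
by rewrite ge0_fin_numE// (lt_trans uxe)// ltry.
Qed.

(** * Almost everywhere statements and integrals of nonnegative real functions *)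

Section RealIntegral.
Context d {X : measurableType d} {R : realType}.
Variable mu : {measure set X -> \bar R}.
Implicit Types (D : set X) (f g h : X -> R).

Lemma ae_imp (P Q : X -> Prop) : (forall t, P t -> Q t) ->
  {ae mu, forall t, P t} -> {ae mu, forall t, Q t}.
Proof. by move=> PQ; apply: filterS. Qed.

Lemma ae_imp2 (P Q S : X -> Prop) : (forall t, P t -> Q t -> S t) ->
  {ae mu, forall t, P t} -> {ae mu, forall t, Q t} -> {ae mu, forall t, S t}.
Proof. by move=> PQ; apply: filterS2. Qed.

Lemma measurable_fun_EFin D f :
  measurable_fun D f -> measurable_fun D (fun t => (f t)%:E).
Proof. by move=> mf; exact/measurable_EFinP. Qed.

(** Replacing all functions by 0 on the exceptional null set turns a.e. convergence into convergence
    everywhere on D; completeness of the measure then carries measurability back to [h]. *)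
Lemma ae_cvg_measurable_fun D (h_ : nat -> X -> R) h : measure_is_complete mu ->
  measurable D ->
  (forall n, measurable_fun D (h_ n)) ->
  {ae mu, forall t, D t -> h_ n t @[n --> \oo] --> h t} ->
  measurable_fun D h.
Proof.
move=> cmu mD mh [N [mN N0 hN]].
have mDN : measurable (D `\` N) by exact: measurableD.
apply/measurable_EFinP.
apply: (@ae_measurable_fun _ X R mu cmu D
  (fun t => (patch (fun=> 0) (D `\` N) h t)%:E)).
  exists N; split => // t /= nt; apply: contrapT => Nt; apply: nt => Dt.
  by rewrite patchT// inE.
apply: measurable_fun_EFin.
apply: (@measurable_fun_cvg _ X R D (fun n => patch (fun=> 0) (D `\` N) (h_ n))).
  move=> n; apply/(measurable_restrict _ mDN mD).
  rewrite (setIidr _); last by move=> t [].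
  by apply: measurable_funS (mh n) => // t [].
move=> t Dt; have [DNt|DNt] := boolP (t \in D `\` N).
  rewrite patchT//; under eq_fun do rewrite patchT//.
  apply: contrapT => ht; move: DNt; rewrite inE => -[_]; apply.
  by apply: hN => /= /(_ Dt).
rewrite patchN//; under eq_fun do rewrite patchN//.
exact: cvg_cst.
Qed.

Lemma ae_le_integral_EFin D f g : measurable D ->
  measurable_fun D f ->
  measurable_fun D g ->
  (forall t, 0 <= f t) -> (forall t, 0 <= g t) ->
  {ae mu, forall t, D t -> f t <= g t} ->
  (\int[mu]_(t in D) (f t)%:E <= \int[mu]_(t in D) (g t)%:E)%E.
Proof.
move=> mD mf mg f0 g0 fg; apply: ae_ge0_le_integral => //.
- by move=> t _; rewrite lee_fin.
- exact: measurable_fun_EFin.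
- by move=> t _; rewrite lee_fin.
- exact: measurable_fun_EFin.
Qed.

Lemma integral_EFinD D f g : measurable D ->
  measurable_fun D f ->
  measurable_fun D g ->
  (forall t, 0 <= f t) -> (forall t, 0 <= g t) ->
  (\int[mu]_(t in D) (f t + g t)%:E =
   \int[mu]_(t in D) (f t)%:E + \int[mu]_(t in D) (g t)%:E)%E.
Proof.
move=> mD mf mg f0 g0; rewrite -ge0_integralD//.
- by move=> t _; rewrite lee_fin.
- exact: measurable_fun_EFin.
- by move=> t _; rewrite lee_fin.
- exact: measurable_fun_EFin.
Qed.

Lemma integral_EFinZl D (c : R) f : measurable D ->
  measurable_fun D f ->
  0 <= c -> (forall t, 0 <= f t) ->
  (\int[mu]_(t in D) (c * f t)%:E = c%:E * \int[mu]_(t in D) (f t)%:E)%E.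
Proof.
move=> mD mf c0 f0; rewrite -ge0_integralZl_EFin//.
- by move=> t _; rewrite lee_fin.
- exact: measurable_fun_EFin.
Qed.

Lemma dominated_cvg0 D (f_ : nat -> X -> R) g : measurable D ->
  (forall n, measurable_fun D (f_ n)) ->
  measurable_fun D g ->
  (\int[mu]_(t in D) (g t)%:E < +oo)%E ->
  (forall n t, 0 <= f_ n t) -> (forall t, 0 <= g t) ->
  {ae mu, forall t, D t -> f_ n t @[n --> \oo] --> 0} ->
  (forall n, {ae mu, forall t, D t -> f_ n t <= g t}) ->
  (\int[mu]_(t in D) (f_ n t)%:E)%E @[n --> \oo] --> 0%E.
Proof.
move=> mD mf mg goo f0 g0 fcvg fg.
have := @dominated_convergence _ X R mu D mD (fun n t => (f_ n t)%:E)
  (fun=> 0%E) (fun t => (g t)%:E).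
rewrite integral0; case=> //.
- by move=> n; exact: measurable_fun_EFin.
- by apply: filterS fcvg => t H /H ft; apply: cvg_EFin => //; exact: nearW.
- apply/integrableP; split; first exact: measurable_fun_EFin.
  by under eq_integral do rewrite gee0_abs ?lee_fin//.
- apply: filterS (ae_foralln fg) => t H n Dt.
  by rewrite gee0_abs ?lee_fin//; exact: H.
Qed.

End RealIntegral.

(** * Bochner integral for the Lebesgue measure *)

Section FiniteValued.
Context {R : realType}.
Local Notation LR := (lebesgueType R).
Local Notation mu := (@completed_lebesgue_measure R).

Lemma lebesgue_measurable_itv (i : interval R) : measurable ([set` i] : set LR).
Proof. by apply: sub_caratheodory; exact: measurable_itv. Qed.

Lemma completed_lebesgueE (A : set R) : mu A = lebesgue_measure A.
Proof. by []. Qed.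

Lemma mu_segment_lty (a b : R) : (mu `[a, b]%classic < +oo)%E.
Proof.
by rewrite completed_lebesgueE lebesgue_measure_itv; case: ifP; rewrite ltry.
Qed.

(** The values lie in an arbitrary type, so that pairs, booleans and indices can be treated like
    simple functions. On a domain of finite measure and for values in a normed space this is
    [simple_on], see [simple_onP]. *)
Definition finite_valued (W : Type) (D : set R) (z : R -> W) :=
  finite_set (z @` D) /\
  forall w, measurable (D `&` z @^-1` [set w] : set LR).

Lemma finite_valued_preimage (W : choiceType) D (z : R -> W) (A : set W) :
  finite_valued D z -> measurable (D `&` z @^-1` A : set LR).
Proof.
move=> [fz mz].
rewrite (_ : _ `&` _ = \bigcup_(w in z @` D `&` A) (D `&` z @^-1` [set w])).
  by apply: fin_bigcup_measurable => //; exact: finite_setIl.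
apply/seteqP; split=> [t [Dt Azt]|t [w [_ Aw] [Dt /= ztw]]].
  by exists (z t) => //; split => //; exists t.
by split => //=; rewrite /preimage/= ztw.
Qed.

Lemma finite_valued_dom (W : choiceType) D (z : R -> W) :
  finite_valued D z -> measurable (D : set LR).
Proof.
by move=> /(@finite_valued_preimage _ _ _ setT); rewrite preimage_setT setIT.
Qed.

Lemma finite_valued_comp (W W' : choiceType) D (z : R -> W) (f : W -> W') :
  finite_valued D z -> finite_valued D (f \o z).
Proof.
move=> fz; split=> [|w]; last first.
  by rewrite comp_preimage; exact: finite_valued_preimage.
by rewrite -image_comp; apply: finite_image; exact: fz.1.
Qed.

Lemma finite_valued_pair (W W' : choiceType) D (z : R -> W) (z' : R -> W') :
  finite_valued D z -> finite_valued D z' ->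
  finite_valued D (fun t => (z t, z' t)).
Proof.
move=> [fz mz] [fz' mz']; split=> [|[w w']].
  apply: (@sub_finite_set _ _ ((z @` D) `*` (z' @` D))).
    by move=> _ [t Dt <-]; split => /=; exists t.
  exact: finite_setX.
rewrite (_ : _ `&` _ =
   (D `&` z @^-1` [set w]) `&` (D `&` z' @^-1` [set w'])).
  exact: measurableI.
by apply/seteqP; split=> t /= => [[Dt [<- <-]]|[[Dt <-] [_ <-]]].
Qed.

Lemma finite_valued_sub (W : choiceType) D D' (z : R -> W) :
  measurable (D' : set LR) -> D' `<=` D ->
  finite_valued D z -> finite_valued D' z.
Proof.
move=> mD' D'D fz; split=> [|w].
  by apply: sub_finite_set fz.1; exact: image_subset.
rewrite -(setIidl D'D) -setIA; apply: measurableI => //.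
exact: finite_valued_preimage.
Qed.

Lemma finite_valued_measurable (W : choiceType) D (z : R -> W) (f : W -> R) :
  finite_valued D z -> measurable_fun (D : set LR) (f \o z : LR -> R).
Proof.
by move=> fz mD Y mY; rewrite comp_preimage; exact: finite_valued_preimage.
Qed.

Lemma finite_valued_integral (W : choiceType) D (z : R -> W) (f : W -> R) :
  finite_valued D z -> (forall w, 0 <= f w) ->
  (\int[mu]_(t in D) (f (z t))%:E =
   \sum_(w \in z @` D) (f w)%:E * mu (D `&` z @^-1` [set w]))%E.
Proof.
move=> fz f0; have mD := finite_valued_dom fz.
pose g w : LR -> \bar R := fun t => ((f w) * \1_(D `&` z @^-1` [set w]) t)%:E.
have mS w : measurable (D `&` z @^-1` [set w] : set LR) by exact: fz.2.
rewrite (eq_integral (fun t => \sum_(w \in z @` D) g w t)%E); last first.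
  move=> t /set_mem Dt.
  rewrite (fsbigD1 (z t)) /=; [|exact: fz.1|by exists t].
  rewrite fsbig1 ?adde0 => [|w [_ /= /eqP wz]].
    by rewrite /g indicE mem_set ?mulr1.
  rewrite /g indicE memNset ?mulr0// => -[_ /= ztw].
  by move: wz; rewrite ztw eqxx.
rewrite ge0_integral_fsum//=; last exact: fz.1.
- apply: eq_fsbigr => w _; rewrite /g.
  under eq_integral do rewrite EFinM.
  rewrite ge0_integralZl_EFin; [|exact: mD| | |exact: f0].
  - by rewrite integral_indic// -setIA [_ `&` D]setIC setIA setIid.
  - by move=> t _; rewrite lee_fin.
  - by apply: measurable_fun_EFin; exact: measurable_indic.
- by move=> w; apply: measurable_fun_EFin; apply: measurable_funM => //; exact: measurable_indic.
- by move=> w t Dt; rewrite lee_fin mulr_ge0.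
Qed.

End FiniteValued.

Section SimpleIntegral.
Context {R : realType} {V : normedModType R}.
Local Notation LR := (lebesgueType R).
Local Notation mu := (@completed_lebesgue_measure R).
Variable D : set R.
Hypothesis Dfin : (mu D < +oo)%E.

Lemma simple_onP (s : R -> V) : simple_on D s <-> finite_valued D s.
Proof.
split=> [[? ? _]//|fs]; have mD := finite_valued_dom fs.
by case: (fs) => ? ms; split=> // v _; rewrite (le_lt_trans _ Dfin)//
  le_measure// ?inE.
Qed.

Let mu_level_fin (W : choiceType) (z : R -> W) (A : set W) :
  finite_valued D z -> mu (D `&` z @^-1` A) \is a fin_num.
Proof.
move=> fz; rewrite ge0_fin_numE// (le_lt_trans _ Dfin)//.
rewrite le_measure ?inE//; last exact: finite_valued_dom fz.
exact: finite_valued_preimage.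
Qed.

Let level (W : choiceType) (z : R -> W) w := fine (mu (D `&` z @^-1` [set w])).

(** The integral may be computed on any finer partition, here that of [z]. This is what allows two
    simple functions to be compared on a common partition. *)
Lemma simple_integral_comp (W : choiceType) (z : R -> W) (f : W -> V) :
  finite_valued D z ->
  simple_integral D (f \o z) =
  \sum_(w \in z @` D) fine (mu (D `&` z @^-1` [set w])) *: f w.
Proof.
move=> fz; have fA := fz.1; have mD := finite_valued_dom fz.
(* Additivity over the levels of [z], obtained by integrating the indicator of the level set of
   [f \o z] in two ways. *)
have E v : fine (mu (D `&` (f \o z) @^-1` [set v])) =
    \sum_(w \in z @` D) (f w == v)%:R * level z w.
  have /esym := finite_valued_integral fz (fun w => ler0n R (f w == v)).
  rewrite (eq_integral (fun t : LR =>
      (\1_(D `&` (f \o z) @^-1` [set v]) t)%:E)); last first.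
    move=> t; rewrite inE => Dt; rewrite indicE; congr ((nat_of_bool _)%:R%:E).
    by apply/eqP/idP => [ftv|]; rewrite inE//= => -[].
  rewrite integral_indic//; last first.
    by have := finite_valued_comp f fz; case.
  rewrite setIAC setIid => smu; apply: EFin_inj.
  rewrite fineK; last by rewrite comp_preimage mu_level_fin.
  transitivity (\sum_(w \in z @` D)
     (((f w == v)%:R)%:E * mu (D `&` z @^-1` [set w]))%E); first exact/esym/smu.
  rewrite !fsbig_finite//= -sumEFin; apply: eq_bigr => w _.
  by rewrite EFinM fineK// mu_level_fin.
rewrite /simple_integral.
under eq_fsbigr do rewrite E fsbig_finite// scaler_suml.
have ffA : finite_set ((f \o z) @` D) by rewrite -image_comp; exact: finite_image.
rewrite !fsbig_finite// exchange_big/=; apply: eq_big_seq => w.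
rewrite in_fset_set// => /set_mem[t Dt <-].
rewrite (bigD1_seq (f (z t)))//=; last 2 first.
- by rewrite in_fset_set// mem_set//; exists t.
- exact: finmap.fset_uniq.
rewrite eqxx mul1r big1 ?addr0// => v /negPf.
by rewrite eq_sym => ->; rewrite mul0r scale0r.
Qed.

(** Both functions factor through the pair [(s, s')], whose levels form a common partition; on it
    the bound is the triangle inequality for finite sums. *)
Lemma simple_integral_dist (s s' : R -> V) :
  finite_valued D s -> finite_valued D s' ->
  (`|simple_integral D s - simple_integral D s'|%:E <=
   \int[mu]_(t in D) (`|s t - s' t|)%:E)%E.
Proof.
move=> fs fs'; pose z t := (s t, s' t).
have fz : finite_valued D z by exact: finite_valued_pair.
have -> : s = fst \o z by [].
have -> : s' = snd \o z by [].
rewrite !simple_integral_comp// (@finite_valued_integral _ _ _ _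
  (fun w => `|w.1 - w.2|))//.
have fA := fz.1; rewrite !fsbig_finite// -sumrB.
have -> (G : V * V -> \bar R) (X : seq (V * V)) :
  (forall w, G w = (`|w.1 - w.2| * level z w)%:E) ->
  (\sum_(w <- X) G w)%E = (\sum_(w <- X) `|w.1 - w.2| * level z w)%:E.
- by move=> GE; rewrite -sumEFin; apply: eq_bigr => w _; rewrite GE.
- rewrite lee_fin (le_trans (ler_norm_sum _ _ _))// ler_sum// => w _.
  rewrite -scalerBr normrZ mulrC ger0_norm//.
  exact: fine_ge0.
- by move=> w; rewrite EFinM fineK// mu_level_fin.
Qed.

End SimpleIntegral.

Section LebesgueWrappers.
Context {R : realType}.
Local Notation LR := (lebesgueType R).
Local Notation mu := (@completed_lebesgue_measure R).
Implicit Types (D : set R) (f g h : R -> R).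

(* Named so that [//] does not try to unify the Lebesgue and the Borel
   sigma-algebras, which unfolds both and practically diverges. *)
Definition Lmeasurable (D : set R) : Prop := measurable (D : set LR).

Definition Lmfun D f : Prop := measurable_fun (D : set LR) (f : LR -> R).

Lemma Lmeasurable_itv (i : interval R) : Lmeasurable [set` i].
Proof. exact: lebesgue_measurable_itv. Qed.

Lemma LmeasurableI D D' : Lmeasurable D -> Lmeasurable D' -> Lmeasurable (D `&` D').
Proof. exact: measurableI. Qed.

Lemma LmeasurableD D D' : Lmeasurable D -> Lmeasurable D' -> Lmeasurable (D `\` D').
Proof. exact: measurableD. Qed.

Lemma Lmeasurable_bigcup (D_ : nat -> set R) (P : set nat) :
  (forall n, Lmeasurable (D_ n)) -> Lmeasurable (\bigcup_(n in P) D_ n).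
Proof. by move=> mD; apply: bigcup_measurable => n _; exact: mD. Qed.

Lemma Lmeasurable_bigcap (D_ : nat -> set R) (P : set nat) : P !=set0 ->
  (forall n, Lmeasurable (D_ n)) -> Lmeasurable (\bigcap_(n in P) D_ n).
Proof. by move=> P0 mD; apply: bigcap_measurable => // n _; exact: mD. Qed.

Lemma Lmu_sub_lty D D' : Lmeasurable D' -> Lmeasurable D -> D' `<=` D ->
  (mu D < +oo)%E -> (mu D' < +oo)%E.
Proof. by move=> mD' mD D'D; apply: le_lt_trans; apply: le_measure; rewrite ?inE. Qed.

Lemma Lmfun_cst D (c : R) : Lmfun D (fun=> c).
Proof. exact: measurable_cst. Qed.

Lemma LmfunD D f g : Lmfun D f -> Lmfun D g -> Lmfun D (fun t => f t + g t).
Proof. exact: measurable_funD. Qed.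

Lemma LmfunM D f g : Lmfun D f -> Lmfun D g -> Lmfun D (fun t => f t * g t).
Proof. exact: measurable_funM. Qed.

Lemma LmfunZ D (c : R) f : Lmfun D f -> Lmfun D (fun t => c * f t).
Proof. by apply: LmfunM; exact: Lmfun_cst. Qed.

Lemma Lmfun_comp D f (g : R -> R) : measurable_fun [set: R] g -> Lmfun D f ->
  Lmfun D (g \o f).
Proof. exact: measurableT_comp. Qed.

Lemma Lmfun_norm D f : Lmfun D f -> Lmfun D (fun t => `|f t|).
Proof. by apply: Lmfun_comp; exact: normr_measurable. Qed.

Lemma Lmfun_ler D f g : Lmeasurable D -> Lmfun D f -> Lmfun D g ->
  Lmeasurable (D `&` [set t | f t <= g t]).
Proof.
by move=> mD mf mg; have /(_ mD [set true]) := measurable_fun_ler mf mg; apply.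
Qed.

Lemma Lmfun_ltr D f g : Lmeasurable D -> Lmfun D f -> Lmfun D g ->
  Lmeasurable (D `&` [set t | f t < g t]).
Proof.
by move=> mD mf mg; have /(_ mD [set true]) := measurable_fun_ltr mf mg; apply.
Qed.

Lemma Lmfun_id D : Lmfun D id.
Proof.
move=> mD Y mY; apply: measurableI; first exact: mD.
by apply: sub_caratheodory; exact: mY.
Qed.

Lemma Lmfun_ae_cvg D (h_ : nat -> R -> R) h :
  Lmeasurable D -> (forall n, Lmfun D (h_ n)) ->
  {ae mu, forall t, D t -> h_ n t @[n --> \oo] --> h t} -> Lmfun D h.
Proof. exact: ae_cvg_measurable_fun completed_lebesgue_measure_is_complete. Qed.

Lemma Lae_imp (P Q : R -> Prop) : (forall t, P t -> Q t) ->
  {ae mu, forall t, P t} -> {ae mu, forall t, Q t}.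
Proof. exact: (@ae_imp _ LR R mu P Q). Qed.

Lemma Lae_imp2 (P Q S : R -> Prop) : (forall t, P t -> Q t -> S t) ->
  {ae mu, forall t, P t} -> {ae mu, forall t, Q t} -> {ae mu, forall t, S t}.
Proof. exact: (@ae_imp2 _ LR R mu P Q S). Qed.

Lemma LaeW (P : R -> Prop) : (forall t, P t) -> {ae mu, forall t, P t}.
Proof. exact: (@aeW _ LR R mu P). Qed.

Lemma Lae_foralln (P : nat -> R -> Prop) :
  (forall n, {ae mu, forall t, P n t}) -> {ae mu, forall t, forall n, P n t}.
Proof. exact: (@ae_foralln _ LR R mu P). Qed.

Lemma Lae_neq (r : R) : {ae mu, forall t, t <> r}.
Proof.
exists [set r]; split; last by move=> t /= /contrapT.
  by apply: sub_caratheodory; exact: measurable_set1.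
by rewrite completed_lebesgueE lebesgue_measure_set1.
Qed.

Lemma Lintegral_ge0 D f : (forall t, 0 <= f t) ->
  (0 <= \int[mu]_(t in D) (f t)%:E)%E.
Proof. by move=> f0; apply: integral_ge0 => t _; rewrite lee_fin. Qed.

Lemma le_Lintegral D f g : Lmeasurable D -> Lmfun D f -> Lmfun D g ->
  (forall t, 0 <= f t) -> (forall t, 0 <= g t) ->
  {ae mu, forall t, D t -> f t <= g t} ->
  (\int[mu]_(t in D) (f t)%:E <= \int[mu]_(t in D) (g t)%:E)%E.
Proof. exact: ae_le_integral_EFin. Qed.

Lemma LintegralD D f g : Lmeasurable D -> Lmfun D f -> Lmfun D g ->
  (forall t, 0 <= f t) -> (forall t, 0 <= g t) ->
  (\int[mu]_(t in D) (f t + g t)%:E =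
   \int[mu]_(t in D) (f t)%:E + \int[mu]_(t in D) (g t)%:E)%E.
Proof. exact: integral_EFinD. Qed.

Lemma LintegralZ D (c : R) f : Lmeasurable D -> Lmfun D f ->
  0 <= c -> (forall t, 0 <= f t) ->
  (\int[mu]_(t in D) (c * f t)%:E = c%:E * \int[mu]_(t in D) (f t)%:E)%E.
Proof. exact: integral_EFinZl. Qed.

Lemma Ldominated_cvg0 D (f_ : nat -> R -> R) g : Lmeasurable D ->
  (forall n, Lmfun D (f_ n)) -> Lmfun D g ->
  (\int[mu]_(t in D) (g t)%:E < +oo)%E ->
  (forall n t, 0 <= f_ n t) -> (forall t, 0 <= g t) ->
  {ae mu, forall t, D t -> f_ n t @[n --> \oo] --> 0} ->
  (forall n, {ae mu, forall t, D t -> f_ n t <= g t}) ->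
  (\int[mu]_(t in D) (f_ n t)%:E)%E @[n --> \oo] --> 0%E.
Proof. exact: dominated_cvg0. Qed.

End LebesgueWrappers.

(** * Strongly measurable functions: combination, restriction, extension by zero *)

Section StronglyMeasurable.
Context {R : realType}.
Local Notation LR := (lebesgueType R).
Local Notation mu := (@completed_lebesgue_measure R).
Implicit Types (D : set R).

(** The approximating simple functions are combined by [phi], so joint sequential continuity is
    enough. This covers subtraction as well as the application of an operator to a vector. *)
Lemma strongly_measurable_comp2 (U V W : normedModType R) D
    (f : R -> U) (g : R -> V) (phi : U -> V -> W) : (mu D < +oo)%E ->
  (forall (u_ : nat -> U) (v_ : nat -> V) u v,
    u_ n @[n --> \oo] --> u -> v_ n @[n --> \oo] --> v ->
    phi (u_ n) (v_ n) @[n --> \oo] --> phi u v) ->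
  strongly_measurable D f -> strongly_measurable D g ->
  strongly_measurable D (fun t => phi (f t) (g t)).
Proof.
move=> Dfin phic [s [ss sf]] [s' [ss' sg]].
exists (fun n t => phi (s n t) (s' n t)); split=> [n|].
  apply/(simple_onP Dfin).
  apply: (finite_valued_comp (fun w => phi w.1 w.2)
    (finite_valued_pair ((simple_onP Dfin _).1 (ss n))
                        ((simple_onP Dfin _).1 (ss' n)))).
by apply: Lae_imp2 sf sg => t H1 H2 Dt; apply: phic; [exact: H1|exact: H2].
Qed.

Lemma strongly_measurableB (V : normedModType R) D (f g : R -> V) :
  (mu D < +oo)%E -> strongly_measurable D f -> strongly_measurable D g ->
  strongly_measurable D (fun t => f t - g t).
Proof.
move=> Dfin; apply: (@strongly_measurable_comp2 V V V _ _ _ (fun u v => u - v)) => //.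
by move=> u_ v_ u v; exact: cvgB.
Qed.

Lemma strongly_measurable_dom (V : normedModType R) D (f : R -> V) :
  strongly_measurable D f -> Lmeasurable D.
Proof.
by move=> [s [/(_ 0%N)[? ? _] _]]; apply: (@finite_valued_dom _ _ _ (s 0%N)).
Qed.

Lemma strongly_measurable_norm (V : normedModType R) D (f : R -> V) :
  strongly_measurable D f ->
  Lmfun D (fun t => `|f t|).
Proof.
move=> /[dup] /strongly_measurable_dom mD [s [ss sf]].
apply: (@Lmfun_ae_cvg _ _ (fun n t => `|s n t|)) => //.
  move=> n; have [? ? _] := ss n.
  exact: (@finite_valued_measurable _ _ _ (s n) (fun v => `|v|)).
by apply: Lae_imp sf => t H Dt; apply: cvg_norm; exact: H.
Qed.

Lemma strongly_measurable_sub (V : normedModType R) D D' (f : R -> V) :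
  Lmeasurable D' -> D' `<=` D -> (mu D < +oo)%E ->
  strongly_measurable D f -> strongly_measurable D' f.
Proof.
move=> mD' D'D Dfin /[dup] /strongly_measurable_dom mD [s [ss sf]].
exists s; split=> [n|]; last by apply: Lae_imp sf => t H /D'D; exact: H.
apply/simple_onP; first by apply: Lmu_sub_lty Dfin.
by apply: finite_valued_sub D'D _ => //; apply/(simple_onP Dfin).
Qed.

Lemma finite_valued_patch (V : normedModType R) D D' (s : R -> V) :
  Lmeasurable D' -> D `<=` D' ->
  finite_valued D s -> finite_valued D' (patch (fun=> 0) D s).
Proof.
move=> mD' DD' fs; have mD := finite_valued_dom fs; split=> [|w].
  apply: (@sub_finite_set _ _ ((s @` D) `|` [set 0])).
    move=> _ [t _ <-]; have [Dt|Dt] := boolP (t \in D).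
      by left; rewrite patchT//; exists t => //; exact: set_mem.
    by right; rewrite patchN.
  by rewrite finite_setU; split; [exact: fs.1|exact: finite_set1].
rewrite (_ : _ `&` _ = (D `&` s @^-1` [set w]) `|`
    (D' `\` D) `&` (fun=> 0) @^-1` [set w]).
  apply: measurableU; first exact: fs.2.
  rewrite preimage_cst; case: ifP => _; last by rewrite setI0.
  by rewrite setIT; exact: measurableD.
apply/seteqP; split=> t /=.
  move=> [D't]; have [Dt|Dt] := boolP (t \in D).
    by rewrite patchT// => ?; left; split => //; exact: set_mem.
  by rewrite patchN// => ?; right; split => //; split => //; move=> /mem_set; apply/negP.
move=> [[Dt <-]|[[D't nDt] <-]]; first by rewrite patchT ?inE//; split => //; exact: DD'.
by rewrite patchN ?notin_setE.
Qed.

Lemma strongly_measurable_patch (V : normedModType R) D D' (f : R -> V) :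
  Lmeasurable D' -> D `<=` D' -> (mu D' < +oo)%E ->
  strongly_measurable D f ->
  strongly_measurable D' (patch (fun=> 0) D f).
Proof.
move=> mD' DD' Dfin /[dup] /strongly_measurable_dom mD [s [ss sf]].
exists (fun n => patch (fun=> 0) D (s n)); split=> [n|].
  apply/(simple_onP Dfin); apply: finite_valued_patch => //.
  apply/simple_onP => //.
  by apply: Lmu_sub_lty Dfin.
apply: Lae_imp sf => t H D't; have [Dt|Dt] := boolP (t \in D).
  by rewrite patchT//; under eq_fun do rewrite patchT//; apply: H; exact: set_mem.
by rewrite patchN//; under eq_fun do rewrite patchN//; exact: cvg_cst.
Qed.

Lemma finite_valued_cst (W : choiceType) D (w : W) :
  Lmeasurable D -> finite_valued D (fun=> w).
Proof.
move=> mD; split=> [|w'].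
  by apply: (@sub_finite_set _ _ [set w]); [move=> _ [t _ <-]|exact: finite_set1].
rewrite preimage_cst; case: ifP => _; first by rewrite setIT.
by rewrite setI0; exact: measurable0.
Qed.

Lemma finite_valued_bool D (z : R -> bool) :
  Lmeasurable D -> Lmeasurable (D `&` [set t | z t]) -> finite_valued D z.
Proof.
move=> mD mz; split; [exact: finite_finset|case]; first exact: mz.
rewrite (_ : _ `&` _ = D `\` (D `&` [set t | z t])); first exact: LmeasurableD.
by apply/seteqP; split=> t /= [Dt]; case: (z t) => //= H; split => //; [case|case: H].
Qed.

End StronglyMeasurable.

(** * Existence, uniqueness and norm estimate of the Bochner integral *)

Section BochnerIntegral.
Context {R : realType} {V : completeNormedModType R}.
Local Notation LR := (lebesgueType R).
Local Notation mu := (@completed_lebesgue_measure R).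
Variable D : set R.
Hypothesis Dfin : (mu D < +oo)%E.
Implicit Types f g : R -> V.

Lemma integral_dist_triangle f g h : strongly_measurable D f ->
  strongly_measurable D g -> strongly_measurable D h ->
  (\int[mu]_(t in D) (`|f t - h t|)%:E <=
   \int[mu]_(t in D) (`|f t - g t|)%:E + \int[mu]_(t in D) (`|g t - h t|)%:E)%E.
Proof.
move=> mf mg mh; have mD := strongly_measurable_dom mf.
have mB (f1 f2 : R -> V) : strongly_measurable D f1 -> strongly_measurable D f2 ->
    Lmfun D (fun t => `|f1 t - f2 t|).
  move=> m1 m2; apply: (strongly_measurable_norm (strongly_measurableB Dfin m1 m2)).
rewrite -LintegralD//; [|exact: mB|exact: mB].
apply: le_Lintegral => //; first exact: mB.
- by apply: LmfunD; exact: mB.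
- by apply: (@LaeW R (fun t => D t -> _)) => t _; rewrite -[f t - h t](subrKA (g t)) ler_normD.
Qed.

Lemma simple_strongly_measurable (s : R -> V) :
  simple_on D s -> strongly_measurable D s.
Proof. by move=> ss; exists (fun=> s); split=> //; apply: LaeW => t _; exact: cvg_cst. Qed.

(** In the application [c] is the integral of |f - g|, which may be infinite; [a], [b] are the
    approximation errors of f and g, [d] is the distance from f to the approximant of g, and [x],
    [y] are the distances of the approximate and of the exact integrals. *)
Lemma perturbed_triangle (a b c d : \bar R) (e x y : R) :
  (0 <= a)%E -> (0 <= b)%E -> (0 <= c)%E -> (0 <= d)%E ->
  (a < (e / 4)%:E)%E -> (b < (e / 4)%:E)%E -> (d <= c + b)%E ->
  (x%:E <= a + d)%E -> y <= x + e / 2 -> (y%:E <= c + e%:E)%E.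
Proof.
case: a b c d => [a||] [b||] [c||] [d||]//; rewrite ?leey//.
by rewrite -!EFinD !lte_fin !lee_fin; lra.
Qed.

(** Stated for arbitrary values of the integral, hence usable before existence is known: the case f
    = g yields uniqueness. *)
Lemma is_bochner_integral_dist f g v w :
  is_bochner_integral D f v -> is_bochner_integral D g w ->
  (`|v - w|%:E <= \int[mu]_(t in D) (`|f t - g t|)%:E)%E.
Proof.
move=> [mf [s [ss sf sv]]] [mg [s' [ss' sg sw]]].
apply/lee_addgt0Pr => e e0.
have I0 h1 h2 : (0 <= \int[mu]_(t in D) (`|h1 t - h2 t : V|)%:E)%E.
  by apply: integral_ge0 => t _; rewrite lee_fin.
have e4 : 0 < e / 4 by rewrite divr_gt0.
near \oo => n.
have sfn : (\int[mu]_(t in D) (`|f t - s n t|)%:E < (e / 4)%:E)%E.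
  by near: n; apply: ((ge0_cvge0P _).1 sf).
have sgn : (\int[mu]_(t in D) (`|g t - s' n t|)%:E < (e / 4)%:E)%E.
  by near: n; apply: ((ge0_cvge0P _).1 sg).
have svn : `|v - simple_integral D (s n)| < e / 4.
  by near: n; move/cvgrPdist_lt : sv; apply.
have swn : `|w - simple_integral D (s' n)| < e / 4.
  by near: n; move/cvgrPdist_lt : sw; apply.
have msn := simple_strongly_measurable (ss n).
have msn' := simple_strongly_measurable (ss' n).
have := simple_integral_dist Dfin ((simple_onP Dfin _).1 (ss n))
  ((simple_onP Dfin _).1 (ss' n)).
move=> /le_trans/(_ (integral_dist_triangle msn mf msn')).
have -> : (\int[mu]_(t in D) (`|s n t - f t|)%:E =
  \int[mu]_(t in D) (`|f t - s n t|)%:E)%E.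
  by apply: eq_integral => t _; rewrite distrC.
have := integral_dist_triangle mf mg msn'.
move=> dcb Sad; apply: (perturbed_triangle _ _ _ _ sfn sgn dcb Sad); rewrite ?I0//.
clear -svn swn; rewrite (le_trans (ler_distD (simple_integral D (s n)) _ _))//.
have := ler_distD (simple_integral D (s' n)) (simple_integral D (s n)) w.
rewrite [`|simple_integral D (s' n) - w|]distrC.
move: svn swn; set S := simple_integral _ _; set S' := simple_integral _ _.
by clearbody S S'; lra.
Unshelve. all: end_near. Qed.

Lemma is_bochner_integral_unique f v w :
  is_bochner_integral D f v -> is_bochner_integral D f w -> v = w.
Proof.
move=> fv fw; apply/eqP; rewrite -subr_eq0 -normr_le0 -lee_fin.
rewrite (le_trans (is_bochner_integral_dist fv fw))//.
under eq_integral do rewrite subrr normr0.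
by rewrite integral0.
Qed.

Lemma ex_bochner_integral f : strongly_measurable D f ->
  (\int[mu]_(t in D) (`|f t|)%:E < +oo)%E ->
  exists v, is_bochner_integral D f v.
Proof.
move=> mf foo; have mD := strongly_measurable_dom mf.
have [s [ss sf]] := mf.
have mnf := strongly_measurable_norm mf.
(* Truncation makes 3 |f| a dominating function for |f - s'|. Since 2 > 1, the truncation is
   eventually inactive wherever f(t) is nonzero; where f(t) = 0 it forces the value 0. *)
pose s' n t := if `|s n t| <= 2 * `|f t| then s n t else 0.
have fs' n : finite_valued D (s' n).
  have fsn := (simple_onP Dfin _).1 (ss n).
  pose z t := `|s n t| <= 2 * `|f t|.
  have fz : finite_valued D z.
    have mzT : Lmeasurable (D `&` [set t | z t]).
      apply: Lmfun_ler => //; first exact: (finite_valued_measurable (fun v : V => `|v|) fsn).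
      exact: LmfunZ.
    exact: finite_valued_bool.
  exact: (finite_valued_comp (fun w => if w.2 then w.1 else 0)
    (finite_valued_pair fsn fz)).
have ss' n : simple_on D (s' n) by exact/(simple_onP Dfin).
have ms' n := simple_strongly_measurable (ss' n).
have s'f t n : `|s' n t| <= 2 * `|f t|.
  by rewrite /s'; case: ifP => //; rewrite normr0 mulr_ge0.
have cvs : (\int[mu]_(t in D) (`|f t - s' n t|)%:E)%E @[n --> \oo] --> 0%E.
  apply: (@Ldominated_cvg0 _ _ (fun n t => `|f t - s' n t|) (fun t => 3 * `|f t|)) => //.
  - by move=> n; apply: strongly_measurable_norm; exact: strongly_measurableB.
  - exact: LmfunZ.
  - by rewrite LintegralZ// lte_mul_pinfty.
  - apply: Lae_imp sf => t H Dt; apply/norm_cvg0P.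
    rewrite -(subrr (f t)); apply: cvgB; first exact: cvg_cst.
    have /cvgrPdist_lt sft := H Dt.
    apply/cvgrPdist_lt => e e0; have [ft0|ft0] := eqVneq (f t) 0.
      apply: nearW => n; have := s'f t n.
      by rewrite ft0 normr0 mulr0 normr_le0 => /eqP ->; rewrite subrr normr0.
    near=> n; have sft1 : `|f t - s n t| < `|f t|.
      by near: n; apply: sft; rewrite normr_gt0.
    rewrite /s' ifT; first by near: n; exact: sft.
    have : `|s n t| <= `|f t| + `|f t - s n t|.
      by rewrite -{1}(subKr (f t) (s n t)) ler_normB.
    lra.
  - move=> n; apply: (@LaeW R (fun t => D t -> _)) => t _; rewrite (le_trans (ler_normB _ _))//.
    by have := s'f t n; lra.
have cS : cauchy (simple_integral D (s' n) @[n --> \oo]).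
  apply: cauchy_exP => e e0.
  have e2 : 0 < e / 2 by rewrite divr_gt0.
  have [|N _ HN] := (ge0_cvge0P _).1 cvs _ e2.
    by move=> n; exact: Lintegral_ge0.
  exists (simple_integral D (s' N)); exists N => // n /= Nn.
  rewrite -ball_normE/= -lte_fin.
  apply: (le_lt_trans (simple_integral_dist Dfin (fs' N) (fs' n))).
  apply: (le_lt_trans (integral_dist_triangle (ms' N) mf (ms' n))).
  rewrite [e]splitr EFinD lteD//; last exact: HN.
  under eq_integral do rewrite distrC.
  exact: HN (leqnn _).
exists (lim (simple_integral D (s' n) @[n --> \oo])).
split => //; exists s'; split => //.
exact/cauchy_cvgP.
Unshelve. all: end_near. Qed.

Lemma bochner_integralP f : strongly_measurable D f ->
  (\int[mu]_(t in D) (`|f t|)%:E < +oo)%E ->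
  is_bochner_integral D f (bochner_integral D f).
Proof. by move=> mf foo; exact: (xgetPex 0 (ex_bochner_integral mf foo)). Qed.

End BochnerIntegral.

Section BochnerPatch.
Context {R : realType} {V : completeNormedModType R}.
Local Notation mu := (@completed_lebesgue_measure R).
Variables D D' : set R.
Hypotheses (mD' : Lmeasurable D') (DD' : D `<=` D') (D'fin : (mu D' < +oo)%E).
Implicit Types f g : R -> V.

(** Extension by zero can only change the level set of the value 0, whose term vanishes; both sums
    are therefore taken over the range enlarged by 0. *)
Lemma simple_integral_patch (s : R -> V) :
  simple_integral D' (patch (fun=> 0) D s) = simple_integral D s.
Proof.
rewrite /simple_integral.
rewrite (@fsbig_widen _ _ _ _ (patch (fun=> 0) D s @` D') ((s @` D) `|` [set 0])).
- rewrite (@fsbig_widen _ _ _ _ (s @` D) ((s @` D) `|` [set 0])).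
  + apply: eq_fsbigr => v _; have [->|v0] := eqVneq v 0; first by rewrite !scaler0.
    congr (fine (mu _) *: _); apply/seteqP; split=> t /= [D't].
      have [Dt|Dt] := boolP (t \in D).
        by rewrite patchT// => ?; split => //; exact: set_mem.
      by rewrite patchN// => v0'; move: v0; rewrite v0' eqxx.
    by move=> <-; rewrite patchT ?inE//; split => //; exact: DD'.
  + by move=> ? ?; left.
  + by move=> v [[//|->] _] /=; rewrite scaler0.
- move=> _ [t _ <-]; have [Dt|Dt] := boolP (t \in D).
    by left; rewrite patchT//; exists t => //; exact: set_mem.
  by right; rewrite patchN.
- move=> v [[[t Dt stv]|->] nv] /=; last by rewrite scaler0.
  by exfalso; apply: nv; exists t; [exact: DD'|rewrite patchT ?inE].
Qed.

Lemma is_bochner_integral_patch f v : is_bochner_integral D f v ->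
  is_bochner_integral D' (patch (fun=> 0) D f) v.
Proof.
move=> [mf [s [ss sf sv]]]; have mD := strongly_measurable_dom mf.
split; first exact: strongly_measurable_patch.
exists (fun n => patch (fun=> 0) D (s n)); split.
- move=> n; apply/(simple_onP D'fin); apply: finite_valued_patch => //.
  by apply/simple_onP; [apply: Lmu_sub_lty D'fin|exact: ss].
- rewrite (_ : (fun n => _) =
    (fun n => \int[mu]_(t in D) (`|f t - s n t|)%:E)%E)//.
  apply/funext => n; rewrite -[in RHS](setIidr DD') [RHS]integral_mkcondr.
  apply: eq_integral => t _; have [Dt|Dt] := boolP (t \in D).
    by rewrite !patchT.
  by rewrite !patchN// subrr normr0.
- by under eq_fun do rewrite simple_integral_patch.
Qed.

(** Moves an integral over [[0, t]] to the fixed interval [0,T], where kernels at different times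
    can be subtracted. As [bochner_integral] is a choice, the equality rests on existence and
    uniqueness. *)
Lemma bochner_integral_patch f : strongly_measurable D f ->
  (\int[mu]_(t in D) (`|f t|)%:E < +oo)%E ->
  bochner_integral D' (patch (fun=> 0) D f) = bochner_integral D f.
Proof.
move=> mf foo; have mD := strongly_measurable_dom mf.
have Dfin : (mu D < +oo)%E by apply: Lmu_sub_lty D'fin.
have P := is_bochner_integral_patch (bochner_integralP Dfin mf foo).
exact: (is_bochner_integral_unique D'fin (xgetPex 0 (ex_intro _ _ P)) P).
Qed.

Lemma bochner_integral_dist f g :
  strongly_measurable D' f -> strongly_measurable D' g ->
  (\int[mu]_(t in D') (`|f t|)%:E < +oo)%E ->
  (\int[mu]_(t in D') (`|g t|)%:E < +oo)%E ->
  (`|bochner_integral D' f - bochner_integral D' g|%:E <=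
   \int[mu]_(t in D') (`|f t - g t|)%:E)%E.
Proof.
by move=> mf mg foo goo; apply: is_bochner_integral_dist => //;
  exact: bochner_integralP.
Qed.

End BochnerPatch.

(** * Strong measurability tested by distances to a dense sequence *)

Section SeparableMeasurability.
Context {R : realType} {E : normedModType R}.
Local Notation mu := (@completed_lebesgue_measure R).

Lemma separable_dense_seq : separable E ->
  exists e : nat -> E, forall x eps, 0 < eps -> exists j, `|x - e j| < eps.
Proof.
move=> [A /pcard_surjP[a sa] dA].
have E_ne : exists j, A (a j).
  have [x [_ Ax]] := dA setT (ex_intro _ 0 I) openT.
  by have [j _ ajx] := sa _ Ax; exists j; rewrite ajx.
exists a => x eps eps0.
have [|y [/= xy Ay]] := dA (ball x eps) _ (ball_open _ _).
  by exists x; exact: ballxx.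
by have [j _ ajy] := sa _ Ay; exists j; move: xy; rewrite -ball_normE/= ajy.
Qed.

Variables (e : nat -> E).
Hypothesis eP : forall x eps, 0 < eps -> exists j, `|x - e j| < eps.

Fixpoint nearest (x : E) n : nat :=
  if n is m.+1 then
    if `|x - e m.+1| < `|x - e (nearest x m)| then m.+1 else nearest x m
  else 0%N.

Lemma nearest_min x n j : (j <= n)%N -> `|x - e (nearest x n)| <= `|x - e j|.
Proof.
elim: n => [|n IH] /=; first by rewrite leqn0 => /eqP ->.
rewrite leq_eqVlt ltnS => /predU1P[->|jn]; first by case: ltP.
by case: ltP => [xn|_]; [rewrite (le_trans (ltW xn))// IH|exact: IH].
Qed.

(** A form of Pettis's criterion: the nearest point to f(t) among e_0, ..., e_n converges to f(t) by
    density. Its index and the running minimal distance are shown measurable together, by induction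
    on n. *)
Lemma strongly_measurable_dist D (f : R -> E) : Lmeasurable D -> (mu D < +oo)%E ->
  (forall j, Lmfun D (fun t => `|f t - e j|)) -> strongly_measurable D f.
Proof.
move=> mD Dfin mf.
have fv n : finite_valued D (fun t => nearest (f t) n) /\
    Lmfun D (fun t => `|f t - e (nearest (f t) n)|).
  elim: n => [|n [IH1 IH2]] /=.
    split; last exact: mf.
    exact: finite_valued_cst.
  have mlt := Lmfun_ltr mD (mf n.+1) IH2.
  split.
    exact: (finite_valued_comp (fun w => if w.2 then n.+1 else w.1)
      (finite_valued_pair IH1 (finite_valued_bool mD mlt))).
  rewrite (_ : (fun t => _) =
    (fun t => Num.min `|f t - e n.+1| `|f t - e (nearest (f t) n)|)).
    exact: measurable_minr (mf n.+1) IH2.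
  by apply/funext => t; case: ltP.
exists (fun n t => e (nearest (f t) n)); split=> [n|].
  by apply/simple_onP => //; exact: (finite_valued_comp e (fv n).1).
apply: LaeW => t _; apply/cvgrPdist_lt => eps eps0.
have [j xj] := eP (f t) eps0.
by near=> n; apply: le_lt_trans xj; apply: nearest_min; near: n; exact: nbhs_infty_ge.
Unshelve. all: end_near. Qed.

End SeparableMeasurability.

Section BoundedEndoApplication.
Context {R : realType} {E : normedModType R}.
Local Notation mu := (@completed_lebesgue_measure R).
Implicit Types (u : bounded_endo E) (x y : E).

Lemma bendo_linear u : linear u.
Proof. by have /asboolP[] := bendoP u. Qed.

Lemma bendo0 u : u 0 = 0.
Proof.
by have := bendo_linear u (-1) 0 0; rewrite scaler0 addr0 => ->; rewrite scaleN1r addNr.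
Qed.

Lemma bendoZ u a x : u (a *: x) = a *: u x.
Proof. by have := bendo_linear u a x 0; rewrite !addr0 bendo0 addr0. Qed.

Lemma bendoB u x y : u (x - y) = u x - u y.
Proof. by have := bendo_linear u (-1) y x; rewrite !scaleN1r => uxy; rewrite addrC uxy addrC. Qed.

Lemma bendoBl u u' x : (u - u') x = u x - u' x.
Proof. by []. Qed.

Lemma bendo_norm_le u x : `|u x| <= `|u| * `|x|.
Proof.
have [->|x0] := eqVneq x 0; first by rewrite bendo0 !normr0 mulr0.
have nx0 : 0 < `|x| by rewrite normr_gt0.
have nx : `|(`|x|)^-1 *: x| <= 1.
  by rewrite normrZ normfV normr_id mulVf// gt_eqF.
have := opnorm_ub u nx.
rewrite bendoZ normrZ normfV normr_id ler_pdivrMl// mulrC; exact.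
Qed.

Lemma bendo_cvg (u_ : nat -> bounded_endo E) (x_ : nat -> E) u x :
  u_ n @[n --> \oo] --> u -> x_ n @[n --> \oo] --> x ->
  u_ n (x_ n) @[n --> \oo] --> u x.
Proof.
move=> uu xx.
have H : (`|u_ n - u| * `|x_ n| + `|u| * `|x_ n - x|) @[n --> \oo] --> (0 : R).
  rewrite [X in _ --> X](_ : 0 = 0 * `|x| + `|u| * 0); last by rewrite mul0r mulr0 addr0.
  apply: cvgD.
    apply: cvgM; last exact: cvg_norm.
    by apply/norm_cvg0P; rewrite -(subrr u); apply: cvgB => //; exact: cvg_cst.
  apply: cvgM; first exact: cvg_cst.
  by apply/norm_cvg0P; rewrite -(subrr x); apply: cvgB => //; exact: cvg_cst.
apply/cvgrPdist_lt => eps eps0.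
move/cvgrPdist_lt/(_ _ eps0) : H; apply: filterS => n.
rewrite sub0r normrN ger0_norm ?addr_ge0 ?mulr_ge0//; apply: le_lt_trans.
rewrite distrC -[_ - u x](subrKA (u (x_ n))) (le_trans (ler_normD _ _))//.
by rewrite -bendoBl -bendoB lerD// bendo_norm_le.
Qed.

Lemma strongly_measurable_bendo D (K : R -> bounded_endo E) (v : R -> E) :
  (mu D < +oo)%E -> strongly_measurable D K -> strongly_measurable D v ->
  strongly_measurable D (fun t => K t (v t)).
Proof.
by move=> Dfin; apply: (strongly_measurable_comp2 Dfin); exact: bendo_cvg.
Qed.

End BoundedEndoApplication.

(** * Hoelder bounds on a subset *)

Section LnormPatch.
Context d {X : measurableType d} {R : realType}.
Variable mu : {measure set X -> \bar R}.
Variable D : set X.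
Hypothesis mD : measurable D.
Implicit Types (f g h : X -> R).

Let restr f : X -> R := patch (fun=> 0) D f.

Let measurable_restr f : measurable_fun D f -> measurable_fun [set: X] (restr f).
Proof. by move=> mf; apply/(measurable_restrict _ mD measurableT); rewrite setTI. Qed.

Let integral_restr (phi : X -> \bar R) f : (forall t, D t -> phi t = (f t)%:E) ->
  (forall t, ~ D t -> phi t = 0%E) ->
  (\int[mu]_t phi t = \int[mu]_(t in D) (f t)%:E)%E.
Proof.
move=> Dphi phi0; rewrite [RHS]integral_mkcond; apply: eq_integral => t _.
have [Dt|Dt] := boolP (t \in D); first by rewrite patchT// Dphi//; exact: set_mem.
by rewrite patchN// phi0// => /mem_set; exact/negP.
Qed.

Lemma Lnorm_patch_lty (r : R) f : 0 < r -> (forall t, 0 <= f t) ->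
  (('N[mu]_r%:E[EFin \o restr f] < +oo)%E <->
   (\int[mu]_(t in D) (f t `^ r)%:E < +oo)%E).
Proof.
move=> r0 f0; rewrite unlock.
have -> : (\int[mu]_t `|(EFin \o restr f) t| `^ r =
    \int[mu]_(t in D) (f t `^ r)%:E)%E.
  apply: integral_restr => t Dt; rewrite /restr/=.
    by rewrite patchT ?inE//= ger0_norm.
  by rewrite patchN ?notin_setE//= normr0 powR0// gt_eqF.
set J := (\int[mu]_(t in D) _)%E.
have J0 : (0 <= J)%E by apply: integral_ge0 => t _; rewrite lee_fin powR_ge0.
split=> H; last exact: poweR_lty.
rewrite ltNge leye_eq; apply/negP => /eqP JE.
by move: H; rewrite JE poweRyr ?ltxx// invr_neq0// gt_eqF.
Qed.

(** For finite q this is the usual inequality. For q = +oo conjugacy forces p = 1, and f is bounded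
    by its essential supremum; positivity of the total measure identifies the norm with that
    supremum. *)
Lemma hoelder_patch (p : R) (q : \bar R) f g : 1 <= p -> (1 < q)%E ->
  ((p^-1)%:E + q^-1 = 1)%E -> (0 < mu [set: X])%E ->
  measurable_fun D f -> measurable_fun D g ->
  (forall t, 0 <= f t) -> (forall t, 0 <= g t) ->
  (\int[mu]_(t in D) (f t * g t)%:E <=
   'N[mu]_q[EFin \o restr f] * 'N[mu]_p%:E[EFin \o restr g])%E.
Proof.
move=> p1 q1 pq muT mf mg f0 g0.
have mrf := measurable_restr mf; have mrg := measurable_restr mg.
have p0 : 0 < p by exact: lt_le_trans p1.
have E1 : ('N[mu]_1[EFin \o (restr f \* restr g)%R] =
    \int[mu]_(t in D) (f t * g t)%:E)%E.
  rewrite Lnorm1; apply: integral_restr => t Dt; rewrite /restr/=.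
    by rewrite !patchT ?inE// ger0_norm// mulr_ge0.
  by rewrite !patchN ?notin_setE// mul0r normr0.
case: q q1 pq => [r|_|//].
  rewrite lte_fin => r1 pq; have r0 : 0 < r by exact: lt_trans r1.
  rewrite -E1; apply: hoelder => //.
  move: pq; rewrite inver gt_eqF// -EFinD => -[].
  by rewrite addrC.
move=> pq; have p1' : p = 1.
  move: pq; rewrite invey adde0 => -[] /(congr1 GRing.inv).
  by rewrite invrK invr1.
have -> : ('N[mu]_+oo[EFin \o restr f] = ess_sup mu (abse \o (EFin \o restr f)))%E.
  by rewrite unlock muT.
rewrite p1' Lnorm1.
set M := ess_sup _ _.
have Mae : {ae mu, forall t, (`|restr f t|%:E <= M)%E}.
  exact: (ess_sup_ge mu (abse \o (EFin \o restr f))).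
(* A negative essential supremum of |f| would make the exceptional null set the whole space. *)
have M0 : (0 <= M)%E.
  have : {ae mu, forall t, (0 <= M)%E}.
    by apply: filterS Mae => t; apply: le_trans; rewrite lee_fin.
  move=> [N [mN N0 sub]]; rewrite leNgt; apply/negP => M0.
  have NT : N = setT.
    by apply/seteqP; split=> // t _; apply: sub => /=; rewrite leNgt M0.
  by move: muT; rewrite -NT N0 ltxx.
rewrite -E1 Lnorm1 -ge0_integralZl//=; last first.
  by apply: measurable_fun_EFin; exact: measurableT_comp.
apply: ae_ge0_le_integral => //=.
- by apply: measurable_fun_EFin; apply: measurableT_comp => //; exact: measurable_funM.
- by move=> t _; rewrite mule_ge0// lee_fin.
- by apply: emeasurable_funM => //; apply: measurable_fun_EFin; exact: measurableT_comp.
- by apply: filterS Mae => t Mt _; rewrite normrM EFinM lee_wpmul2r// lee_fin.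
Qed.

End LnormPatch.

Section LpSpace.
Context {R : realType}.
Local Notation LR := (lebesgueType R).
Local Notation mu := (@completed_lebesgue_measure R).
Implicit Types (V : normedModType R) (D : set R).

Lemma Lp_norm_lty V (r : R) D (f : R -> V) : 0 < r ->
  (Lp_norm r%:E D f < +oo)%E <->
  (\int[mu]_(t in D) (`|f t| `^ r)%:E < +oo)%E.
Proof.
move=> r0; rewrite /Lp_norm.
exact: (@Lnorm_patch_lty _ LR R mu D r (fun t : LR => `|f t|) r0
  (fun t => normr_ge0 (f t))).
Qed.

Lemma LmuT_gt0 : (0 < mu [set: R])%E.
Proof.
have : (0 < mu `[0%R, 1%R]%classic)%E.
  by rewrite completed_lebesgueE lebesgue_measure_itv/= lte_fin ltr01 oppr0 adde0.
move=> /lt_le_trans; apply; apply: le_measure; rewrite ?inE.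
- exact: Lmeasurable_itv.
- exact: (@measurableT _ LR).
- by move=> ? _.
Qed.

Lemma Lp_hoelder V V' (p : R) (q : \bar R) D (f : R -> V) (g : R -> V') :
  1 <= p -> (1 < q)%E -> ((p^-1)%:E + q^-1 = 1)%E ->
  strongly_measurable D f -> strongly_measurable D g ->
  (\int[mu]_(t in D) (`|f t| * `|g t|)%:E <= Lp_norm q D f * Lp_norm p%:E D g)%E.
Proof.
move=> p1 q1 pq mf mg; have mD := strongly_measurable_dom mf.
exact: (@hoelder_patch _ LR R mu D mD p q (fun t => `|f t|) (fun t => `|g t|)
  p1 q1 pq LmuT_gt0 (strongly_measurable_norm mf) (strongly_measurable_norm mg)
  (fun t => normr_ge0 _) (fun t => normr_ge0 _)).
Qed.

Lemma Lp_norm_dominated V V' (r : R) D (f : R -> V) (g : R -> V') (c : R) :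
  1 <= r -> strongly_measurable D f -> strongly_measurable D g -> 0 <= c ->
  {ae mu, forall t, D t -> `|f t| <= c * `|g t|} ->
  (Lp_norm r%:E D g < +oo)%E -> (Lp_norm r%:E D f < +oo)%E.
Proof.
move=> r1 mf mg c0 fg; have mD := strongly_measurable_dom mf.
have r0 : 0 < r by exact: lt_le_trans r1.
have mpow V0 (h : R -> V0) : strongly_measurable D h -> Lmfun D (fun t => `|h t| `^ r).
  by move=> mh; exact: (Lmfun_comp (measurable_powR r) (strongly_measurable_norm mh)).
move=> /(Lp_norm_lty _ _ r0) goo; apply/(Lp_norm_lty _ _ r0).
apply: (@le_lt_trans _ _ (\int[mu]_(t in D) (c `^ r * `|g t| `^ r)%:E)%E).
  apply: le_Lintegral => //.
  - exact: mpow.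
  - by apply: LmfunZ; exact: mpow.
  - by move=> t; rewrite mulr_ge0// powR_ge0.
  - apply: Lae_imp fg => t H Dt; rewrite -powRM//.
    by apply: ge0_ler_powR; rewrite ?nnegrE ?mulr_ge0 ?(ltW r0)//; exact: H.
by rewrite LintegralZ ?powR_ge0//; [rewrite lte_mul_pinfty// lee_fin powR_ge0|exact: mpow].
Qed.

Lemma strongly_measurable_real D (f : R -> R) : Lmeasurable D -> (mu D < +oo)%E ->
  Lmfun D f -> strongly_measurable D f.
Proof.
move=> mD Dfin mf.
have [e eP] : exists e : nat -> R, forall x eps, 0 < eps -> exists j, `|x - e j| < eps.
  exists (fun n => ratr (odflt 0 (unpickle n))) => x eps eps0.
  have [|r] := @rat_in_itvoo R (x - eps) (x + eps); first by lra.
  rewrite in_itv/= => /andP[rx xr]; exists (pickle r).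
  by rewrite pickleK/= ltr_distl; apply/andP; split; lra.
apply: (strongly_measurable_dist eP) => // j.
by apply: Lmfun_norm; apply: LmfunD => //; exact: Lmfun_cst.
Qed.

Lemma Lp_norm_sum3 (r : R) D (a b : R -> R) : 1 <= r -> (mu D < +oo)%E ->
  Lp_space r%:E D a -> Lp_space r%:E D b ->
  Lp_space r%:E D (fun t => 1 + `|a t| + `|b t|).
Proof.
move=> r1 Dfin [ma ia] [mb ib]; have mD := strongly_measurable_dom ma.
have r0 : 0 < r by exact: lt_le_trans r1.
have mna := strongly_measurable_norm ma.
have mnb := strongly_measurable_norm mb.
have mg : Lmfun D (fun t => 1 + `|a t| + `|b t|).
  by apply: LmfunD => //; apply: LmfunD => //; exact: Lmfun_cst.
split; first exact: strongly_measurable_real.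
have mpow (h : R -> R) : Lmfun D (fun t => `|h t|) -> Lmfun D (fun t => `|h t| `^ r).
  exact: (Lmfun_comp (measurable_powR r)).
apply/(Lp_norm_lty _ _ r0).
(* With m the largest of 1, |a|, |b|, one has (1 + |a| + |b|)^r <= (3 m)^r, and m^r is at most the
   sum of the three powers. *)
apply: (@le_lt_trans _ _
  (\int[mu]_(t in D) (3 `^ r * (1 + (`|a t| `^ r + `|b t| `^ r)))%:E)%E).
  apply: le_Lintegral => //.
  - by apply: mpow; exact: Lmfun_norm.
  - apply: LmfunZ; apply: LmfunD; first exact: Lmfun_cst.
    by apply: LmfunD; exact: mpow.
  - apply: (@LaeW _ (fun t => D t -> _)) => t _.
    pose m := Num.max 1 (Num.max `|a t| `|b t|).
    have m1 : 1 <= m by rewrite le_max lexx.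
    have am : `|a t| <= m by rewrite !le_max lexx orbT.
    have bm : `|b t| <= m by rewrite !le_max lexx !orbT.
    rewrite ger0_norm ?addr_ge0//.
    apply: (@le_trans _ _ ((3 * m) `^ r)).
      by apply: ge0_ler_powR; rewrite ?nnegrE ?addr_ge0 ?mulr_ge0 ?(ltW r0)//; lra.
    rewrite powRM//; last exact: le_trans m1.
    rewrite ler_wpM2l ?powR_ge0//.
    have [a0 b0] : 0 <= `|a t| `^ r /\ 0 <= `|b t| `^ r by rewrite !powR_ge0.
    rewrite {1}/m; case: (leP 1 (Num.max _ _)) => _; last by rewrite powR1; lra.
    by case: (leP `|a t| `|b t|) => _; lra.
rewrite LintegralZ ?powR_ge0//; last first.
- by apply: LmfunD; [exact: Lmfun_cst|apply: LmfunD; exact: mpow].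
rewrite lte_mul_pinfty ?lee_fin ?powR_ge0//.
rewrite LintegralD//; last 2 first.
- exact: Lmfun_cst.
- by apply: LmfunD; exact: mpow.
rewrite LintegralD//; [|exact: mpow|exact: mpow].
apply: lte_add_pinfty; first by rewrite integral_cst// mul1e.
apply: lte_add_pinfty; first exact: (Lp_norm_lty D a r0).1.
exact: (Lp_norm_lty D b r0).1.
Qed.

End LpSpace.

(** * The integral operator of the kernel *)

(** Compactness of the segment: thresholds N that work near each single point are merged into one
    that works everywhere. It supplies uniformity in t in the convergence of [kernel_op], the choice
    of the exponential weight, and uniform continuity. *)
Lemma segment_eventually {R : realType} (a b : R) (P : nat -> R -> Prop) :
  (forall t, `[a, b]%classic t -> exists N, \forall u \near t,
     `[a, b]%classic u -> forall m, (N <= m)%N -> P m u) ->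
  exists N, forall m, (N <= m)%N -> forall u, `[a, b]%classic u -> P m u.
Proof.
move=> H.
have /compact_near_coveringP/near_covering_withinP := @segment_compact R a b.
move=> /(_ nat \oo%classic P _) [].
  move=> t It; have [N HN] := H t It.
  exists ((fun u => `[a, b]%classic u -> forall m, (N <= m)%N -> P m u),
          [set m | (N <= m)%N]); first by split => //; exact: nbhs_infty_ge.
  by move=> [u m] /= [Hu Nm] Iu; exact: Hu.
by move=> N _ HN; exists N.
Qed.

Section Kernel.
Context {R : realType} {E : completeNormedModType R} (T : R).
Local Notation mu := (@completed_lebesgue_measure R).
Local Notation I := (`[0, T]%classic : set R).
Variables (k : R -> R -> bounded_endo E) (gamma : R -> R).
Local Notation kt := (kernel_ext k).

Let mI : Lmeasurable I. Proof. exact: Lmeasurable_itv. Qed.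
Let Ifin : (mu I < +oo)%E. Proof. exact: mu_segment_lty. Qed.

Hypothesis k_meas : forall t, I t -> strongly_measurable `[0, t]%classic (k t).
Hypothesis gamma_meas : Lmfun I gamma.
Hypothesis gamma_ge1 : forall t, 1 <= gamma t.
Hypothesis k_gamma : forall t, I t ->
  (\int[mu]_(s in I) (`|kt t s| * gamma s)%:E < +oo)%E.
Hypothesis k_gamma_cvg : forall t, I t -> forall eps : R, 0 < eps ->
  \forall u \near t, I u ->
    (\int[mu]_(s in I) (`|kt u s - kt t s| * gamma s)%:E < eps%:E)%E.

Let gamma_ge0 t : 0 <= gamma t. Proof. exact: le_trans ler01 (gamma_ge1 t). Qed.

Let subI t : I t -> `[0, t]%classic `<=` I.
Proof.
move=> /=; rewrite in_itv/= => /andP[_ tT] s /=; rewrite !in_itv/= => /andP[-> st].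
exact: le_trans tT.
Qed.

Lemma kernel_ext_meas t : I t -> strongly_measurable I (kt t).
Proof. by move=> It; apply: strongly_measurable_patch => //; [exact: subI|exact: k_meas]. Qed.

Lemma kernel_ext_gt t s : t < s -> kt t s = 0.
Proof.
by move=> ts; rewrite /kernel_ext patchN// notin_setE/= in_itv/= (leNgt s) ts andbF.
Qed.

Let kt_norm t : I t -> Lmfun I (fun s => `|kt t s|).
Proof. by move=> /kernel_ext_meas; exact: strongly_measurable_norm. Qed.

Let ktB_norm t u : I t -> I u -> Lmfun I (fun s => `|kt u s - kt t s|).
Proof.
by move=> It Iu; apply: strongly_measurable_norm; apply: strongly_measurableB => //;
  exact: kernel_ext_meas.
Qed.

(** The class of admissible densities: for these, [k_gamma] makes s |-> k(t,s) v(s) Bochner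
    integrable for every t in I. *)
Definition gamma_dominated (v : R -> E) := strongly_measurable I v /\
  exists2 C, 0 <= C & {ae mu, forall s, I s -> `|v s| <= C * gamma s}.

Definition kernel_op (v : R -> E) (t : R) : E :=
  bochner_integral `[0, t] (fun s => k t s (v s)).

Lemma kernel_ext_app_meas t v : I t -> gamma_dominated v ->
  strongly_measurable I (fun s => kt t s (v s)).
Proof. by move=> It [mv _]; apply: strongly_measurable_bendo => //; exact: kernel_ext_meas. Qed.

Lemma kernel_ext_app_lty t v : I t -> gamma_dominated v ->
  (\int[mu]_(s in I) (`|kt t s (v s)|)%:E < +oo)%E.
Proof.
move=> It dv; have [mv [C C0 vC]] := dv.
apply: (@le_lt_trans _ _ (\int[mu]_(s in I) (C * (`|kt t s| * gamma s))%:E)%E).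
  apply: le_Lintegral => //.
  - exact: strongly_measurable_norm (kernel_ext_app_meas It dv).
  - by apply: LmfunZ; apply: LmfunM => //; exact: kt_norm.
  - by move=> s; rewrite !mulr_ge0.
  - apply: Lae_imp vC => s H Is; rewrite (le_trans (bendo_norm_le _ _))//.
    by rewrite mulrCA ler_wpM2l// H.
rewrite LintegralZ//; last 2 first.
- by apply: LmfunM => //; exact: kt_norm.
- by move=> s; rewrite mulr_ge0.
by rewrite lte_mul_pinfty ?lee_fin// k_gamma.
Qed.

Lemma kernel_opE t v : I t -> gamma_dominated v ->
  kernel_op v t = bochner_integral I (fun s => kt t s (v s)).
Proof.
move=> It dv; have [mv _] := dv.
have E1 : (fun s => kt t s (v s)) = patch (fun=> 0) `[0, t] (fun s => k t s (v s)).
  apply/funext => s; rewrite /kernel_ext.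
  have [st|st] := boolP (s \in `[0, t]%classic); first by rewrite !patchT.
  by rewrite !patchN.
rewrite E1 (bochner_integral_patch mI (subI It) Ifin)//.
  apply: strongly_measurable_bendo => //; first exact: mu_segment_lty.
    exact: k_meas.
  by apply: (strongly_measurable_sub _ (subI It) Ifin mv); exact: Lmeasurable_itv.
apply: le_lt_trans (kernel_ext_app_lty It dv).
rewrite -(setIidr (subI It)) integral_mkcondr; under eq_integral.
  move=> s _.
  rewrite (_ : _ s = (`|kt t s (v s)|)%:E); first over.
  rewrite /kernel_ext; have [st|st] := boolP (s \in `[0, t]%classic).
    by rewrite !patchT.
  by rewrite !patchN// normr0.
by [].
Qed.

Lemma kernel_op_dist t u v w : I t -> I u -> gamma_dominated v -> gamma_dominated w ->
  (`|kernel_op v t - kernel_op w u|%:E <=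
   \int[mu]_(s in I) (`|kt t s (v s) - kt u s (w s)|)%:E)%E.
Proof.
move=> It Iu dv dw; rewrite !kernel_opE//; apply: bochner_integral_dist => //.
- exact: kernel_ext_app_meas.
- exact: kernel_ext_app_meas.
- exact: kernel_ext_app_lty.
- exact: kernel_ext_app_lty.
Qed.

Lemma kernel_op_le t v w (b : R -> R) : I t -> gamma_dominated v -> gamma_dominated w ->
  Lmfun I b -> (forall s, 0 <= b s) ->
  {ae mu, forall s, I s -> `|v s - w s| <= b s} ->
  (`|kernel_op v t - kernel_op w t|%:E <=
   \int[mu]_(s in I) (`|kt t s| * b s)%:E)%E.
Proof.
move=> It dv dw mb b0 vwb; apply: (le_trans (kernel_op_dist It It dv dw)).
apply: le_Lintegral => //.
- apply: strongly_measurable_norm; apply: strongly_measurableB => //;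
    exact: kernel_ext_app_meas.
- by apply: LmfunM => //; exact: kt_norm.
- by move=> s; rewrite mulr_ge0.
- apply: Lae_imp vwb => s H Is; rewrite -bendoB (le_trans (bendo_norm_le _ _))//.
  by rewrite ler_wpM2l// H.
Qed.

Lemma kernel_op_continuous v : gamma_dominated v -> {within I, continuous (kernel_op v)}.
Proof.
move=> dv; have [mv [C C0 vC]] := dv.
apply/subspace_continuousP => t It; apply/cvgrPdist_le => eps eps0.
have e0 : 0 < eps / (C + 1) by rewrite divr_gt0// ltr_wpDl.
have := k_gamma_cvg It e0; rewrite near_withinE; apply: filterS => u Hu Iu.
rewrite -lee_fin distrC (le_trans (kernel_op_dist Iu It dv dv))//.
apply: (@le_trans _ _ (\int[mu]_(s in I) (C * (`|kt u s - kt t s| * gamma s))%:E)%E).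
  apply: le_Lintegral => //.
  - apply: strongly_measurable_norm; apply: strongly_measurableB => //;
      exact: kernel_ext_app_meas.
  - by apply: LmfunZ; apply: LmfunM => //; exact: ktB_norm.
  - by move=> s; rewrite !mulr_ge0.
  - apply: Lae_imp vC => s H Is; rewrite -bendoBl (le_trans (bendo_norm_le _ _))//.
    by rewrite mulrCA ler_wpM2l// H.
rewrite LintegralZ//; last 2 first.
- by apply: LmfunM => //; exact: ktB_norm.
- by move=> s; rewrite mulr_ge0.
apply: (@le_trans _ _ (C%:E * (eps / (C + 1))%:E)%E).
  by rewrite lee_wpmul2l ?lee_fin// ltW// Hu.
by rewrite -EFinM lee_fin mulrCA ler_piMr ?(ltW eps0)// ler_pdivrMr ?mul1r; lra.
Qed.

Lemma kernel_op_is_cts v : gamma_dominated v -> @is_cts R T E (kernel_op v \o \val).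
Proof.
by move=> /kernel_op_continuous/subspace_sigL_continuousP cv; apply/asboolP.
Qed.

(** Total thanks to the default 0, so that densities need not carry a proof; for dominated densities
    continuity holds and the first branch is taken. *)
Definition kernel_CI (v : R -> E) : CI T E :=
  if pselect (@is_cts R T E (kernel_op v \o \val)) is left cv then MkCI cv else 0.

Lemma kernel_CIE v (t : set_type I) : gamma_dominated v ->
  kernel_CI v t = kernel_op v (\val t).
Proof.
move=> /kernel_op_is_cts cv; rewrite /kernel_CI; by case: pselect.
Qed.

(** At a fixed t this is dominated convergence. Continuity of the kernel in the gamma-weighted norm
    spreads the estimate to a neighbourhood of t, with the same threshold on m, and compactness
    makes it uniform. *)
Lemma kernel_op_cvg (v_ : nat -> R -> E) v C : 0 <= C ->
  strongly_measurable I v -> (forall m, strongly_measurable I (v_ m)) ->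
  {ae mu, forall s, I s -> `|v s| <= C * gamma s} ->
  (forall m, {ae mu, forall s, I s -> `|v_ m s| <= C * gamma s}) ->
  {ae mu, forall s, I s -> v_ m s @[m --> \oo] --> v s} ->
  forall eps, 0 < eps -> exists N, forall m, (N <= m)%N -> forall t, I t ->
    `|kernel_op (v_ m) t - kernel_op v t| <= eps.
Proof.
move=> C0 mv mv_ vC v_C v_v eps eps0.
have dv : gamma_dominated v by split => //; exists C.
have dv_ m : gamma_dominated (v_ m) by split => //; exists C.
(* The minimum agrees a.e. with the distance on I, but satisfies its bound at every point, so the
   estimates below hold pointwise. *)
pose b m s := Num.min `|v_ m s - v s| (2 * C * gamma s).
have mb m : Lmfun I (b m).
  apply: measurable_minr; last exact: LmfunZ.
  by apply: strongly_measurable_norm; exact: strongly_measurableB.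
have b0 m s : 0 <= b m s by rewrite le_min normr_ge0 !mulr_ge0.
have bC m s : b m s <= 2 * C * gamma s by rewrite ge_min lexx orbT.
have vb m : {ae mu, forall s, I s -> `|v_ m s - v s| <= b m s}.
  apply: Lae_imp2 vC (v_C m) => s H1 H2 Is; rewrite le_min lexx/=.
  rewrite (le_trans (ler_normB _ _))//; have := H1 Is; have := H2 Is; lra.
apply: segment_eventually => t It.
have e2 : 0 < eps / 2 by rewrite divr_gt0.
have C1 : 0 < 2 * C + 1 by rewrite ltr_wpDl// mulr_ge0.
have eC : 0 < eps / 2 / (2 * C + 1) by rewrite divr_gt0.
have mktg u : I u -> Lmfun I (fun s => `|kt u s| * gamma s).
  by move=> Iu; apply: LmfunM => //; exact: kt_norm.
have cv0 : (\int[mu]_(s in I) (`|kt t s| * b m s)%:E)%E @[m --> \oo] --> 0%E.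
  apply: (@Ldominated_cvg0 _ _ (fun m s => `|kt t s| * b m s)
     (fun s => 2 * C * (`|kt t s| * gamma s))) => //.
  - by move=> m; apply: LmfunM => //; exact: kt_norm.
  - by apply: LmfunZ; exact: mktg.
  - rewrite LintegralZ ?mulr_ge0//; [|exact: mktg|by move=> s; rewrite mulr_ge0].
    by rewrite lte_mul_pinfty ?lee_fin ?mulr_ge0// k_gamma.
  - by move=> m s; rewrite mulr_ge0.
  - by move=> s; rewrite !mulr_ge0.
  - apply: Lae_imp v_v => s H Is; rewrite -(mulr0 `|kt t s|).
    apply: cvgM; first exact: cvg_cst.
    apply/cvgrPdist_le => e e0; move/cvgrPdist_le/(_ _ e0) : (H Is).
    apply: filterS => m; rewrite sub0r normrN ger0_norm// distrC.
    by apply: le_trans; rewrite ge_min lexx.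
  - move=> m; apply: (@LaeW _ (fun s => I s -> _)) => s _.
    by rewrite mulrCA ler_wpM2l.
have [|N _ HN] := (ge0_cvge0P _).1 cv0 _ e2.
  by move=> m; apply: Lintegral_ge0 => s; rewrite mulr_ge0.
exists N; have := k_gamma_cvg It eC; apply: filterS => u Hu Iu m Nm.
rewrite -lee_fin (le_trans (kernel_op_le Iu (dv_ m) dv (mb m) (b0 m) (vb m)))//.
apply: (@le_trans _ _ (\int[mu]_(s in I) (`|kt t s| * b m s +
    2 * C * (`|kt u s - kt t s| * gamma s))%:E)%E).
  apply: le_Lintegral => //.
  - by apply: LmfunM => //; exact: kt_norm.
  - apply: LmfunD; first by apply: LmfunM => //; exact: kt_norm.
    by apply: LmfunZ; apply: LmfunM => //; exact: ktB_norm.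
  - by move=> s; rewrite mulr_ge0.
  - by move=> s; rewrite addr_ge0 ?mulr_ge0.
  - apply: (@LaeW _ (fun s => I s -> _)) => s _.
    apply: (@le_trans _ _ ((`|kt t s| + `|kt u s - kt t s|) * b m s)).
      by rewrite ler_wpM2r// -{1}(subrKC (kt t s) (kt u s)) ler_normD.
    by rewrite mulrDl lerD2l mulrCA ler_wpM2l.
rewrite LintegralD//; last 4 first.
- by apply: LmfunM => //; exact: kt_norm.
- by apply: LmfunZ; apply: LmfunM => //; exact: ktB_norm.
- by move=> s; rewrite mulr_ge0.
- by move=> s; rewrite !mulr_ge0.
rewrite LintegralZ ?mulr_ge0//; last 2 first.
- by apply: LmfunM => //; exact: ktB_norm.
- by move=> s; rewrite mulr_ge0.
rewrite [eps]splitr EFinD leeD//; first by rewrite ltW// HN.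
apply: (@le_trans _ _ ((2 * C)%:E * (eps / 2 / (2 * C + 1))%:E)%E).
  by rewrite lee_wpmul2l ?lee_fin ?mulr_ge0// ltW// Hu.
rewrite -EFinM lee_fin mulrCA ler_piMr ?(ltW e2)// ler_pdivrMr// mul1r; lra.
Qed.

(* Bielecki's weight: for a large exponent the operator w |-> int k w becomes a
   strict contraction, because e^(lam s) is concentrated near s = t. *)
Lemma kernel_exp_weight : exists2 lam : R, 0 <= lam & forall t, I t ->
  (\int[mu]_(s in I) (`|kt t s| * (gamma s * expR (lam * s)))%:E <=
   (4^-1 * expR (lam * t))%:E)%E.
Proof.
have [N HN] : exists N, forall m, (N <= m)%N -> forall t, I t ->
  (\int[mu]_(s in I) (`|kt t s| * (gamma s * expR (m%:R * s)))%:E <=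
   (4^-1 * expR (m%:R * t))%:E)%E; last by exists N%:R => //; exact: HN.
have mexp (m : nat) : Lmfun I (fun s => expR (m%:R * s)).
  apply: (@Lmfun_comp _ _ (fun s => m%:R * s) expR); first exact: measurable_expR.
  by apply: LmfunZ; exact: Lmfun_id.
apply: segment_eventually => t It.
pose G s := `|kt t s| * gamma s.
have mG : Lmfun I G by apply: LmfunM => //; exact: kt_norm.
have G0 s : 0 <= G s by rewrite mulr_ge0.
(* The radius is twice the range [tau] = 1/(n+1) allowed for u below: a time s <= u outside this
   window around t satisfies s <= u - tau. *)
pose A n := `]t - 2 / n.+1%:R, t + 2 / n.+1%:R[%classic : set R.
pose f_ n s := G s * \1_(A n) s.
have f0 n s : 0 <= f_ n s by rewrite mulr_ge0// indicE ler0n.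
have fG n s : f_ n s <= G s by rewrite ler_piMr// indicE lern1 leq_b1.
have mf n : Lmfun I (f_ n).
  apply: LmfunM => //.
  exact: (@measurable_indic _ (lebesgueType R) R I (A n) (Lmeasurable_itv _)).
have cf : (\int[mu]_(s in I) (f_ n s)%:E)%E @[n --> \oo] --> 0%E.
  apply: (@Ldominated_cvg0 _ _ f_ G) => //.
  - exact: k_gamma.
  - apply: Lae_imp (Lae_neq t) => s st _.
    apply/cvgrPdist_lt => e e0.
    have st0 : 0 < `|s - t| by rewrite normr_gt0 subr_eq0; apply/eqP.
    near=> n; rewrite sub0r normrN /f_ indicE memNset ?mulr0 ?normr0//.
    rewrite /A/= in_itv/= -ltr_distl ltNge => /negP; apply.
    rewrite ler_pdivrMr// mulrC -ler_pdivrMr// ltW// (@lt_trans _ _ n%:R) ?ltr_nat//.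
    by near: n; exact: nbhs_infty_gtr.
  - by move=> n; apply: (@LaeW _ (fun s => I s -> _)) => s _; exact: fG.
(* Three contributions will each be at most 1/16, and 3/16 <= 1/4. *)
have e16 : 0 < 16^-1 :> R by rewrite invr_gt0.
have [|n _ Hn] := (ge0_cvge0P _).1 cf _ e16.
  by move=> n; exact: Lintegral_ge0.
have {}Hn := Hn n (leqnn _).
pose tau : R := n.+1%:R^-1.
have tau0 : 0 < tau by rewrite invr_gt0.
have Gfin : (\int[mu]_(s in I) (G s)%:E)%E \is a fin_num.
  by rewrite ge0_fin_numE ?k_gamma//; exact: Lintegral_ge0.
pose g := fine (\int[mu]_(s in I) (G s)%:E)%E.
have g0 : 0 <= g by apply: fine_ge0; exact: Lintegral_ge0.
(* For larger m one has m tau > 16 g, hence e^(m tau) >= 1 + m tau > 16 g. *)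
exists (Num.truncn (16 * g / tau)).+1.
have Ht : \forall u \near t, ball t tau u by exact: nbhsx_ballx.
have Hk := k_gamma_cvg It e16.
move: Ht Hk; apply: filterS2 => u; rewrite -ball_normE/= => utau Hk Iu m Nm.
have {}Hk := Hk Iu.
have mtau : g * expR (- (m%:R * tau)) <= 16^-1.
  rewrite expRN ler_pdivrMr ?expR_gt0// mulrC ler_pdivlMr// mulrC.
  have : 16 * g < m%:R * tau.
    rewrite -ltr_pdivrMr//; apply: (lt_le_trans (truncnS_gt _)).
    by rewrite ler_nat.
  have := expR_ge1Dx (m%:R * tau); lra.
(* With e^(m u) factored out: the cost of replacing the kernel at u by that at t, the part of s in
   the window, where e^(m s) <= e^(m u), and the part at least tau before u. For s > u the kernel
   vanishes. *)
pose h s := `|kt u s - kt t s| * gamma s + (f_ n s + expR (- (m%:R * tau)) * G s).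
have mh1 : Lmfun I (fun s => `|kt u s - kt t s| * gamma s).
  by apply: LmfunM => //; exact: ktB_norm.
have mh2 : Lmfun I (fun s => expR (- (m%:R * tau)) * G s) by exact: LmfunZ.
have mh3 : Lmfun I (fun s => f_ n s + expR (- (m%:R * tau)) * G s) by exact: LmfunD.
have h1 s : 0 <= `|kt u s - kt t s| * gamma s by rewrite mulr_ge0.
have h2 s : 0 <= expR (- (m%:R * tau)) * G s by rewrite mulr_ge0// expR_ge0.
have h3 s : 0 <= f_ n s + expR (- (m%:R * tau)) * G s by rewrite addr_ge0.
apply: (@le_trans _ _ (\int[mu]_(s in I) (expR (m%:R * u) * h s)%:E)%E).
  apply: le_Lintegral => //.
  - by apply: LmfunM; [exact: kt_norm|exact: LmfunM].
  - by apply: LmfunZ; exact: LmfunD.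
  - by move=> s; rewrite !mulr_ge0// expR_ge0.
  - by move=> s; rewrite mulr_ge0 ?expR_ge0// addr_ge0.
  - apply: (@LaeW _ (fun s => I s -> _)) => s _.
    have [us|su] := ltP u s.
      by rewrite kernel_ext_gt// normr0 mul0r mulr_ge0 ?expR_ge0// addr_ge0.
    have eus : expR (m%:R * s) <= expR (m%:R * u) by rewrite ler_expR ler_wpM2l.
    apply: (@le_trans _ _ (`|kt u s - kt t s| * gamma s * expR (m%:R * s)
                           + G s * expR (m%:R * s))).
      rewrite /G -mulrDl mulrA -mulrDl ler_wpM2r ?expR_ge0// ler_wpM2r//.
      by rewrite -{1}(subrKC (kt t s) (kt u s)) [leRHS]addrC ler_normD.
    rewrite mulrDr lerD//; first by rewrite mulrC ler_wpM2r.
    rewrite /f_ indicE; have [sA|sA] := boolP (s \in A n).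
      rewrite mulr1 mulrDr (@le_trans _ _ (expR (m%:R * u) * G s))//.
        by rewrite mulrC ler_wpM2r.
      by rewrite lerDl mulr_ge0// expR_ge0.
    rewrite mulr0 add0r mulrA -expRD mulrC ler_wpM2r// ler_expR -mulrBr ler_wpM2l//.
    move: sA; rewrite notin_setE/A/= in_itv/= -ltr_distl => /negP; rewrite -leNgt -/tau.
    by move: utau; rewrite ltr_distl ler_normr => /andP[? ?] /orP[]; lra.
rewrite LintegralZ ?expR_ge0//; last 2 first.
- exact: LmfunD.
- by move=> s; rewrite addr_ge0.
rewrite LintegralD// LintegralD// LintegralZ ?expR_ge0//.
rewrite [X in (_ <= X%:E)%E]mulrC EFinM lee_wpmul2l ?lee_fin ?expR_ge0//.
apply: (@le_trans _ _ ((16^-1)%:E + ((16^-1)%:E + (16^-1)%:E))%E).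
  apply: leeD; first exact: ltW.
  apply: leeD; first exact: ltW.
  by rewrite -(fineK Gfin) -EFinM lee_fin mulrC.
by rewrite -!EFinD lee_fin; lra.
Unshelve. all: end_near. Qed.

End Kernel.

(** * Finiteness and continuity of the gamma-weighted kernel, by Hoelder *)

Section KernelHoelder.
Context {R : realType} {E : completeNormedModType R} (T p : R) (q : \bar R).
Local Notation mu := (@completed_lebesgue_measure R).
Local Notation I := (`[0, T]%classic : set R).
Hypotheses (p_ge1 : 1 <= p) (q_gt1 : (1 < q)%E).
Hypothesis pq_conj : ((p^-1)%:E + q^-1 = 1)%E.
Variables (k : R -> R -> bounded_endo E) (gamma : R -> R).
Hypotheses (k5 : kernel_Lq T q k) (k6 : kernel_continuous T q k).
Hypothesis gammaLp : Lp_space p%:E I gamma.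
Hypothesis gamma_ge0 : forall t, 0 <= gamma t.

Let k_meas t : I t -> strongly_measurable `[0, t]%classic (k t).
Proof. by move=> /k5[]. Qed.

Let Ifin : (mu I < +oo)%E. Proof. exact: mu_segment_lty. Qed.

Let hoelder_gamma (f : R -> bounded_endo E) : strongly_measurable I f ->
  (\int[mu]_(s in I) (`|f s| * gamma s)%:E <= Lp_norm q I f * Lp_norm p%:E I gamma)%E.
Proof.
move=> mf; have := Lp_hoelder p_ge1 q_gt1 pq_conj mf gammaLp.1.
rewrite (_ : (\int[mu]_(t in I) _)%E = (\int[mu]_(s in I) (`|f s| * gamma s)%:E)%E)//.
by apply: eq_integral => s _; rewrite [`|gamma s|]ger0_norm.
Qed.

Lemma kernel_ext_integral_lty t : I t ->
  (\int[mu]_(s in I) (`|kernel_ext k t s| * gamma s)%:E < +oo)%E.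
Proof.
move=> It; apply: (le_lt_trans (hoelder_gamma (kernel_ext_meas k_meas It))).
have -> : Lp_norm q I (kernel_ext k t) = Lp_norm q `[0, t]%classic (k t).
  rewrite /Lp_norm; congr (Lnorm _ _ _); apply/funext => s /=; congr (_%:E).
  have [st|st] := boolP (s \in `[0, t]%classic).
    rewrite [RHS]patchT// patchT; first by rewrite /kernel_ext patchT.
    move: st It; rewrite !inE/= !in_itv/= => /andP[-> st] /andP[_ tT].
    exact: le_trans tT.
  rewrite [RHS]patchN// /patch; case: ifP => // _.
  by rewrite /kernel_ext patchN// normr0.
have [_ kq] := k5 It.
by rewrite lte_mul_pinfty ?Lnorm_ge0 ?ge0_fin_numE ?Lnorm_ge0//; exact: gammaLp.2.
Qed.

Lemma kernel_ext_integral_cvg t : I t -> forall eps : R, 0 < eps ->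
  \forall u \near t, I u ->
    (\int[mu]_(s in I) (`|kernel_ext k u s - kernel_ext k t s| * gamma s)%:E < eps%:E)%E.
Proof.
move=> It eps eps0; pose N := fine (Lp_norm p%:E I gamma).
have N0 : 0 <= N by apply: fine_ge0; exact: Lnorm_ge0.
have NE : Lp_norm p%:E I gamma = N%:E.
  by rewrite fineK// ge0_fin_numE ?Lnorm_ge0//; exact: gammaLp.2.
have N1 : 0 < N + 1 by rewrite ltr_wpDl.
have e0 : 0 < eps / (N + 1) by rewrite divr_gt0.
have H := (ge0_cvge0P (fun u => Lnorm_ge0 _ _ _)).1 (k6 It) _ e0.
have {}H := H (within_filter _ (nbhs_filter t)).
move: H; rewrite near_withinE; apply: filterS => u Hu Iu.
have {Hu} := Hu Iu.
have mB : strongly_measurable I (fun s => kernel_ext k u s - kernel_ext k t s).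
  by apply: strongly_measurableB => //; exact: kernel_ext_meas.
move=> Hu; apply: (le_lt_trans (hoelder_gamma mB)); rewrite NE.
apply: (@le_lt_trans _ _ ((eps / (N + 1))%:E * N%:E)%E).
  by rewrite lee_wpmul2r ?lee_fin// ltW.
by rewrite -EFinM lte_fin -mulrA gtr_pMr// mulrC ltr_pdivrMr// mul1r ltrDl.
Qed.

End KernelHoelder.

(** * Distance to measurable set-valued maps *)

Section SetDist.
Context {R : realType} {E : normedModType R}.
Implicit Types (A B : set E) (x y : E).

Lemma set_dist_le x y A : A y -> set_dist x A <= `|x - y|.
Proof. by move=> Ay; apply: ge_inf; [exists 0 => _ [z _ <-]|exists y]. Qed.

Lemma set_dist_lt x A r : A !=set0 -> set_dist x A < r ->
  exists2 y, A y & `|x - y| < r.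
Proof.
move=> [y Ay] /inf_lt; case; first by exists `|x - y|, y.
by move=> _ [z Az <-] xz; exists z.
Qed.

Lemma set_dist_lip x y A : A !=set0 -> set_dist x A <= `|x - y| + set_dist y A.
Proof.
move=> A0; rewrite -lerBlDl; apply: lb_le_inf.
  by move: A0 => [z Az]; exists `|y - z|, z.
move=> _ [z Az <-]; rewrite lerBlDl (le_trans (set_dist_le _ Az))//.
exact: ler_distD.
Qed.

(** Boundedness of A makes the distances from points of A to B bounded above, so that the real
    supremum in [hausdorff_dist] really dominates each of them. *)
Lemma set_dist_hausdorff x A B : A !=set0 -> B !=set0 -> bounded_set A ->
  set_dist x B <= set_dist x A + hausdorff_dist A B.
Proof.
move=> A0 B0 /pinfty_ex_gt0[M _ AM].
have H z : A z -> set_dist z B <= hausdorff_dist A B.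
  move=> Az; rewrite /hausdorff_dist le_max; apply/orP; left.
  apply: ub_le_sup; last by exists z.
  move: B0 => [b Bb]; exists (M + `|b|) => _ [y Ay <-].
  rewrite (le_trans (set_dist_le _ Bb))// (le_trans (ler_normB _ _))// lerD2r.
  exact: AM.
rewrite -lerBlDr; apply: lb_le_inf.
  by move: A0 => [z Az]; exists `|x - z|, z.
move=> _ [z Az <-]; rewrite lerBlDr (le_trans (set_dist_lip x z B0))//.
by rewrite lerD2l H.
Qed.

Lemma set_dist_closed x A : A !=set0 -> closed A ->
  (forall eps, 0 < eps -> set_dist x A <= eps) -> A x.
Proof.
move=> A0 cA H; apply: cA => U /nbhs_ballP[eps /= eps0 xU].
have [|y Ay xy] := @set_dist_lt x A eps A0.
  by rewrite (le_lt_trans (H (eps / 2) _)) ?divr_gt0//; lra.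
by exists y; split => //; apply: xU; rewrite -ball_normE.
Qed.

(** The distance from y is at least r exactly when G(t) lies in each open set {z : |y - z| > r -
    1/(n+1)}, and measurability of G controls inclusions in open sets. *)
Lemma set_dist_measurable (T : R) (G : R -> set E) y :
  (forall t, `[0, T]%classic t -> G t !=set0) -> Sigma_measurable T G ->
  Lmfun `[0, T]%classic (fun t => set_dist y (G t)).
Proof.
move=> G0 mG; apply: (measurability _ (RGenCInfty.measurableE R)) => //.
move=> _ [_ [r ->] <-].
pose C n := [set z | r - n.+1%:R^-1 < `|y - z|].
have oC n : open (C n).
  rewrite (_ : C n = (fun z => `|y - z|) @^-1` `]r - n.+1%:R^-1, +oo[%classic).
    apply: open_comp; last exact: interval_open.
    by move=> z _; apply: cvg_norm; apply: cvgB; [exact: cvg_cst|exact: cvg_id].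
  by apply/seteqP; split=> z; rewrite /C/= in_itv/= andbT.
rewrite (_ : _ `&` _ = \bigcap_(n in setT) [set t | `[0, T]%classic t /\ G t `<=` C n]).
  by apply: (Lmeasurable_bigcap (P := setT)); [exists 0%N|move=> n; exact: mG].
apply/seteqP; split=> [t [It]|t H].
  rewrite /= in_itv/= andbT => rd n _; split => // z Gz.
  rewrite /C/= (lt_le_trans _ (set_dist_le _ Gz))// (lt_le_trans _ rd)//.
  by rewrite ltrBlDr ltrDl invr_gt0.
have [It _] := H 0%N Logic.I; split => //; rewrite /= in_itv/= andbT.
apply/ler_addgt0Pr => e e0.
have [n ne] : exists n : nat, n.+1%:R^-1 < e.
  exists (Num.truncn e^-1); rewrite invf_plt ?posrE//; exact: truncnS_gt.
rewrite -lerBlDr; apply: lb_le_inf.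
  by have [z Gz] := G0 t It; exists `|y - z|, z.
move=> _ [z Gz <-]; have [_ /(_ z Gz) rz] := H n Logic.I.
by apply/ltW/(lt_trans _ rz); rewrite ltrD2l ltrN2.
Qed.

End SetDist.

(** * Measurable choice of a first index *)

Section FirstIndex.

(* By convention the first index satisfying an empty predicate is 0. *)
Definition first_nat (P : pred nat) : nat :=
  if pselect (exists n, P n) is left exP then ex_minn exP else 0%N.

Lemma first_natP (P : pred nat) : (exists n, P n) ->
  P (first_nat P) /\ forall m, (m < first_nat P)%N -> ~~ P m.
Proof.
move=> exP; rewrite /first_nat; case: pselect => // exP'.
case: ex_minnP => n Pn Pmin; split => // m; rewrite ltnNge; apply: contra.
exact: Pmin.
Qed.

Lemma first_nat_unique (P : pred nat) n :
  P n -> (forall m, (m < n)%N -> ~~ P m) -> first_nat P = n.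
Proof.
move=> Pn nP; have [Pf fP] := first_natP (ex_intro _ n Pn).
apply/eqP; rewrite eqn_leq; apply/andP; split; rewrite leqNgt.
  by apply/negP => /fP; rewrite Pn.
by apply/negP => /nP; rewrite Pf.
Qed.

Context {R : realType} (D : set R).
Hypothesis mD : Lmeasurable D.

Definition nat_measurable (a : R -> nat) :=
  forall j, Lmeasurable (D `&` [set t | a t = j]).

Lemma nat_measurable_cst j : nat_measurable (fun=> j).
Proof.
move=> i; have [->|ji] := eqVneq i j.
  by rewrite (_ : [set _ | _] = setT) ?setIT//; apply/seteqP; split.
rewrite (_ : [set _ | _] = set0) ?setI0; first exact: (@measurable0 _ (lebesgueType R)).
by apply/seteqP; split=> // t /= jE; move: ji; rewrite jE eqxx.
Qed.

(** A measurable index may be substituted into a family of measurable sets, because D splits into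
    countably many pieces on which the index is constant. *)
Lemma nat_measurable_section (a : R -> nat) (Q : nat -> R -> Prop) :
  nat_measurable a -> (forall i, Lmeasurable (D `&` [set t | Q i t])) ->
  Lmeasurable (D `&` [set t | Q (a t) t]).
Proof.
move=> ma mQ; rewrite (_ : _ `&` _ =
  \bigcup_(i in setT) ((D `&` [set t | a t = i]) `&` (D `&` [set t | Q i t]))).
  by apply: Lmeasurable_bigcup => i; exact: LmeasurableI.
by apply/seteqP; split=> [t [Dt Qt]|t [i _ [[Dt /= <-] [_ /= Qt]]]//]; exists (a t).
Qed.

Lemma nat_measurable_Lmfun (a : R -> nat) (f : nat -> R) :
  nat_measurable a -> Lmfun D (fun t => f (a t)).
Proof.
move=> ma _ Y mY.
rewrite (_ : _ `&` _ = \bigcup_(i in f @^-1` Y) (D `&` [set t | a t = i])).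
  exact: Lmeasurable_bigcup.
apply/seteqP; split=> [t [Dt Yt]|t [i /= Yi [Dt /= ati]]]; first by exists (a t).
by split => //=; rewrite /preimage/= ati.
Qed.

Lemma nat_measurable_first (P : nat -> R -> bool) :
  (forall n, Lmeasurable (D `&` [set t | P n t])) ->
  (forall t, D t -> exists n, P n t) ->
  nat_measurable (fun t => first_nat (P ^~ t)).
Proof.
move=> mP exP j.
have mlt n : Lmeasurable (D `&` [set t | forall m, (m < n)%N -> ~~ P m t]).
  elim: n => [|n IH].
    by rewrite (_ : [set _ | _] = setT) ?setIT//; apply/seteqP; split.
  rewrite (_ : _ `&` _ = (D `&` [set t | forall m, (m < n)%N -> ~~ P m t])
     `\` (D `&` [set t | P n t])); first exact: LmeasurableD.
  apply/seteqP; split=> [t [Dt H]|t [[Dt H] nP]]; split=> //.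
  - by split=> // m mn; apply: H; exact: ltnW.
  - by move=> [_]; apply/negP; exact: H.
  - move=> m; rewrite /= ltnS leq_eqVlt => /predU1P[->|]; last exact: H.
    by apply/negP => Pn; apply: nP.
rewrite (_ : _ `&` _ = (D `&` [set t | P j t]) `&`
    (D `&` [set t | forall m, (m < j)%N -> ~~ P m t])); first exact: LmeasurableI.
apply/seteqP; split=> [t [Dt /= <-]|t [[Dt Pj] [_ nP]]].
  by have [? ?] := first_natP (exP t Dt).
by split => //; exact: first_nat_unique.
Qed.

End FirstIndex.

(** * Countable families of step functions *)

(** Reduces continuity to sequences, for which dominated convergence is available. *)
Lemma normed_seq_continuous {R : realType} {U V : normedModType R} (f : U -> V) :
  (forall h (u_ : nat -> U), u_ n @[n --> \oo] --> h ->
     f (u_ n) @[n --> \oo] --> f h) -> continuous f.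
Proof.
move=> H h; apply/cvgrPdist_lt => eps eps0; apply: contrapT => nH.
have /choice[u_ uP] n : exists u, `|h - u| < n.+1%:R^-1 /\ ~ (`|f h - f u| < eps).
  apply: contrapT => /forallNP nu; apply: nH.
  have n0 : 0 < n.+1%:R^-1 :> R by rewrite invr_gt0.
  have : \forall u \near h, ball h n.+1%:R^-1 u by exact: nbhsx_ballx.
  apply: filterS => u; rewrite -ball_normE/= => hu; apply: contrapT => fu.
  exact: (nu u).
have uh : u_ n @[n --> \oo] --> h.
  apply/cvgrPdist_lt => e e0; near=> n; apply: lt_trans (uP n).1 _.
  rewrite invf_plt ?posrE// (@lt_trans _ _ n%:R) ?ltr_nat//.
  by near: n; exact: nbhs_infty_gtr.
have /cvgrPdist_lt/(_ _ eps0)[n _ Hn] := H h u_ uh.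
by have := Hn n (leqnn n); exact: (uP n).2.
Unshelve. all: end_near. Qed.

(** Only the finitely many tests up to the first success matter, so a finite intersection of
    neighbourhoods suffices. *)
Lemma first_nat_near {U : Type} (F : set_system U) {FF : Filter F}
    (P : U -> pred nat) (P0 : pred nat) :
  (forall j, \forall u \near F, P u j = P0 j) -> (exists n, P0 n) ->
  \forall u \near F, first_nat (P u) = first_nat P0.
Proof.
move=> H ex0; have [Pf fP] := first_natP ex0.
have Hn n : \forall u \near F, forall j, (j <= n)%N -> P u j = P0 j.
  elim: n => [|n IH].
    by apply: filterS (H 0%N) => u Hu j; rewrite leqn0 => /eqP ->.
  apply: filterS2 IH (H n.+1) => u IHu Hu j.
  by rewrite leq_eqVlt => /predU1P[->//|]; exact: IHu.
apply: filterS (Hn (first_nat P0)) => u Hu; apply: first_nat_unique.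
  by rewrite Hu.
by move=> m mf; rewrite Hu ?fP// ltnW.
Qed.

Section StepFunctions.
Context {R : realType} {E : normedModType R} (T : R).
Local Notation I := (`[0, T]%classic : set R).
Hypothesis T_ge0 : 0 <= T.
Variable e : nat -> E.
Hypothesis eP : forall x eps, 0 < eps -> exists j, `|x - e j| < eps.

Let mI : Lmeasurable I. Proof. exact: Lmeasurable_itv. Qed.

(* The index j codes a mesh 1/m and the list of the values, themselves indices
   into the dense sequence e, taken on the successive intervals of the mesh. *)
Definition step_label (j : nat) (t : R) : nat :=
  let c := odflt (0%N, [::]) (unpickle j : option (nat * seq nat)) in
  nth 0%N c.2 (Num.truncn (c.1%:R * t)).

Lemma step_label_measurable j : nat_measurable I (step_label j).
Proof.
rewrite /step_label; set c := odflt _ _ => l.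
apply: (nat_measurable_section (a := fun t => Num.truncn (c.1%:R * t))
  (Q := fun i _ => nth 0%N c.2 i = l)) => [i|i]; last exact: nat_measurable_cst.
have m1 : Lmfun I (fun t => c.1%:R * t) by apply: LmfunZ; exact: Lmfun_id.
rewrite (_ : _ `&` _ = (I `&` [set t | i%:R <= c.1%:R * t]) `&`
    (I `&` [set t | c.1%:R * t < i.+1%:R])).
  by apply: LmeasurableI; [apply: Lmfun_ler|apply: Lmfun_ltr] => //; exact: Lmfun_cst.
apply/seteqP; split=> [t [It /= <-]|t [[It /= it] [_ ti]]].
  have : 0 <= c.1%:R * t by rewrite mulr_ge0//; move: It; rewrite /= in_itv/= => /andP[].
  by move=> /truncn_itv/andP[].
by split => //; apply: truncn_def; rewrite it.
Qed.

(** Makes the supremum in [step_dist] that of a bounded set. In the bound, the term |e_0| accounts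
    for the default label past the end of the list. *)
Lemma step_label_bounded j : exists M, forall t, `|e (step_label j t)| <= M.
Proof.
rewrite /step_label; set c := odflt _ _.
have bnd (s : seq nat) n : `|e (nth 0%N s n)| <= `|e 0%N| + \sum_(l <- s) `|e l|.
  elim: s n => [|l s IH] [|n]; rewrite ?big_nil ?addr0 ?big_cons//=.
    by rewrite addrCA lerDl addr_ge0// sumr_ge0.
  by rewrite (le_trans (IH n))// addrCA lerDr.
by eexists => t; exact: bnd.
Qed.

Lemma CI_unif_continuous (x : CI T E) eps : 0 < eps ->
  exists m, forall u v : set_type I, `|\val u - \val v| <= m.+1%:R^-1 ->
    `|x u - x v| <= eps.
Proof.
move=> eps0; have /asboolP cx := cfunP x.
pose f := valL_ (0 : E) (cfun x).
have fE (u : set_type I) : f (\val u) = x u by exact: (congr1 (@^~ u) (valLK 0 (cfun x))).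
have /subspace_continuousP cf := (subspace_valL_continuousP' _ (0 : E) x).2 cx.
have [N HN] : exists N, forall m, (N <= m)%N -> forall u, I u ->
    forall v, I v -> `|u - v| <= m.+1%:R^-1 -> `|f u - f v| <= eps.
  apply: segment_eventually => t It.
  have e2 : 0 < eps / 2 by rewrite divr_gt0.
  have /cvgrPdist_le/(_ _ e2) := cf t It.
  rewrite near_withinE => /nbhs_ballP[d /= d0 Hd].
  have d2 : 0 < d / 2 by rewrite divr_gt0.
  exists (Num.truncn (d / 2)^-1).
  have : \forall u \near t, ball t (d / 2) u by exact: nbhsx_ballx.
  apply: filterS => u; rewrite -ball_normE/= => tu Iu m Nm v Iv uv.
  have md : m.+1%:R^-1 < d / 2.
    rewrite invf_plt ?posrE//; apply: lt_le_trans (truncnS_gt _) _.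
    by rewrite ler_nat ltnS.
  have Hu : `|f t - f u| <= eps / 2.
    by apply: Hd => //; rewrite -ball_normE/=; lra.
  have Hv : `|f t - f v| <= eps / 2.
    apply: Hd => //; rewrite -ball_normE/=.
    apply: (le_lt_trans (ler_distD (u : R) t v)); rewrite [d]splitr ltrD//.
    exact: le_lt_trans md.
  by have := ler_distD (f t) (f u) (f v); rewrite [`|f u - f t|]distrC; lra.
exists N => u v uv; rewrite -!fE; apply: (HN N (leqnn N)) => //.
  exact: set_mem (valP u).
exact: set_mem (valP v).
Qed.

Lemma step_label_approx (x : CI T E) eps : 0 < eps ->
  exists j, forall u : set_type I, `|x u - e (step_label j (\val u))| <= eps.
Proof.
move=> eps0; have e2 : 0 < eps / 2 by rewrite divr_gt0.
have [m Hm] := CI_unif_continuous x e2.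
pose f := valL_ (0 : E) (cfun x).
have fE (u : set_type I) : f (\val u) = x u by exact: (congr1 (@^~ u) (valLK 0 (cfun x))).
have /choice[l lP] i : exists l, `|f (i%:R / m.+1%:R) - e l| < eps / 2 by exact: eP.
(* On each mesh interval the value approximates x at the left endpoint; the last entry of the list
   is needed for the interval that contains T. *)
exists (pickle (m.+1, mkseq l (Num.truncn (m.+1%:R * T)).+1)) => u.
pose i := Num.truncn (m.+1%:R * sval u).
rewrite /step_label pickleK/= -/i.
have : I (sval u) by exact: set_mem (valP u).
rewrite /= in_itv/= => /andP[u0 uT].
have mu0 : 0 <= m.+1%:R * sval u by rewrite mulr_ge0.
have := truncn_itv mu0; rewrite -/i => /andP[iu ui].
rewrite nth_mkseq; last by rewrite ltnS /i le_truncn// ler_wpM2l.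
have m0 : 0 < m.+1%:R :> R by [].
have iu' : i%:R / m.+1%:R <= sval u by rewrite ler_pdivrMr// mulrC.
have Ii : i%:R / m.+1%:R \in I.
  by rewrite inE/= in_itv/= divr_ge0//= (le_trans iu').
pose v : set_type I := SigSub Ii.
have H1 : `|x u - x v| <= eps / 2.
  apply: Hm; rewrite /= ger0_norm ?subr_ge0//.
  have : sval u <= i.+1%:R / m.+1%:R by rewrite ler_pdivlMr// mulrC ltW.
  by rewrite -natr1 mulrDl mul1r lerBlDl.
have H2 : `|x v - e (l i)| <= eps / 2 by rewrite -fE ltW//; exact: lP.
by have := ler_distD (x v) (x u) (e (l i)); lra.
Qed.

Definition step_dist (j : nat) (x : CI T E) : R :=
  sup [set `|x u - e (step_label j (\val u))| | u in [set: set_type I]].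

Lemma step_dist_ub j (x : CI T E) u : `|x u - e (step_label j (\val u))| <= step_dist j x.
Proof.
apply: ub_le_sup; last by exists u.
have [M HM] := step_label_bounded j.
exists (`|x| + M) => _ [v _ <-]; rewrite (le_trans (ler_normB _ _))// lerD//.
exact: maxnorm_ub.
Qed.

Lemma step_dist_le j (x : CI T E) M :
  (forall u, `|x u - e (step_label j (\val u))| <= M) -> step_dist j x <= M.
Proof.
move=> H; apply: ge_sup; last by move=> _ [u _ <-].
have I0 : (0 : R) \in I by rewrite inE/= in_itv/= lexx.
by exists `|x (SigSub I0) - e (step_label j 0)|, (SigSub I0).
Qed.

Lemma step_dist_lip j (x y : CI T E) : step_dist j x <= step_dist j y + `|x - y|.
Proof.
apply: step_dist_le => u; apply: (le_trans (ler_distD (y u) _ _)).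
rewrite [leRHS]addrC lerD//.
  exact: (maxnorm_ub (x - y) u).
exact: step_dist_ub.
Qed.

Lemma step_dist_near (U : topologicalType) (x : U -> CI T E) j h r :
  x u @[u --> h] --> x h -> step_dist j (x h) <> r ->
  \forall u \near h, (step_dist j (x u) < r) = (step_dist j (x h) < r).
Proof.
move=> cx /eqP nr; have d0 : 0 < `|step_dist j (x h) - r| by rewrite normr_gt0 subr_eq0.
move/cvgrPdist_lt/(_ _ d0) : cx; apply: filterS => u Hu.
have := step_dist_lip j (x h) (x u); have := step_dist_lip j (x u) (x h).
rewrite distrC => L1 L2; have [hr|rh|/eqP] := ltgtP (step_dist j (x h)) r.
- by apply: le_lt_trans L1 _; rewrite ltr0_norm ?subr_lt0// in Hu; lra.
- by apply/negbTE; rewrite -leNgt; rewrite gtr0_norm ?subr_gt0// in Hu; lra.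
- by rewrite (negbTE nr).
Qed.

End StepFunctions.

(** * Approximate selections and their iteration *)

Lemma ler_norm_dist {R : realType} {V : normedModType R} (u v : V) :
  `|v| <= `|u| + `|u - v|.
Proof. by rewrite -{1}(subKr u v) ler_normB. Qed.

Lemma normed_continuousP {R : realType} {U V : normedModType R} (f : U -> V) :
  (forall h eps, 0 < eps -> \forall u \near h, `|f h - f u| <= eps) -> continuous f.
Proof. by move=> H h; apply/cvgrPdist_le => eps; exact: H. Qed.

Lemma dist_thirds {R : realType} {V : normedModType R} (a b c d : V) (eps : R) :
  `|a - b| <= eps / 3 -> `|b - c| <= eps / 3 -> `|d - c| <= eps / 3 -> `|a - d| <= eps.
Proof.
move=> ab bc; rewrite distrC => cd; apply: (le_trans (ler_distD b a d)).
apply: (le_trans (lerD ab (le_trans (ler_distD c b d) (lerD bc cd)))); lra.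
Qed.

Section Arithmetic.
Context {R : realType}.
Implicit Types (g w b r : R).

Lemma domination_arith (v s d d0 z a g X C S : R) :
  v <= C * g -> s <= d + S * g -> d <= v + d0 -> d0 <= z + a -> a <= g * X ->
  z <= g -> v + s <= (2 * C + 1 + X + S) * g.
Proof.
move=> H1 H2 H3 H4 H5 H6; apply: (@le_trans _ _ (2 * (C * g) + g + g * X + S * g)).
  by lra.
by rewrite le_eqVlt; apply/orP; left; apply/eqP; ring.
Qed.

Lemma step_arith g w bw : g <= w -> 0 <= w -> 2 * w <= bw ->
  4^-1 * g + bw + 8^-1 * g <= 2 * bw.
Proof. lra. Qed.

Lemma halving_arith b w n : 0 <= b -> 0 <= w ->
  8 * b * 2^-1 ^+ n.+1 * w <= 8 * b * w * 2^-1 ^+ n.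
Proof.
move=> b0 w0; have -> : 8 * b * 2^-1 ^+ n.+1 * w = 2^-1 * (8 * b * w * 2^-1 ^+ n).
  by rewrite exprS; ring.
by rewrite ler_piMl ?mulr_ge0 ?exprn_ge0// invf_le1// ler1n.
Qed.

Lemma quarter_arith g n : 0 <= g -> 2^-1 ^+ n / 4 * g <= g * 2^-1 ^+ n.
Proof.
move=> g0; rewrite mulrC ler_wpM2l// ler_pdivrMr// ler_peMr ?exprn_ge0//.
by rewrite ler1n.
Qed.

Lemma selection_arith (s c d z a g b r : R) :
  s <= a * r -> d <= c + z -> c <= g * r -> z <= g * (b * r) ->
  s + d <= (a + g + g * b) * r.
Proof. by move=> H1 H2 H3 H4; rewrite !mulrDl -(mulrA g); lra. Qed.

Lemma shift_arith a b c d : b <= c + d -> d <= 1 -> a + b + 2 <= a + c + 2 + 1 :> R.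
Proof. lra. Qed.

End Arithmetic.

Lemma geometric_cvg {R : realType} {V : completeNormedModType R} (u : nat -> V) (c : R) :
  (forall n, `|u n.+1 - u n| <= c * 2^-1 ^+ n) ->
  u n @[n --> \oo] --> lim (u n @[n --> \oo]) /\
  forall n, `|lim (u n @[n --> \oo]) - u n| <= 2 * c * 2^-1 ^+ n.
Proof.
move=> Hu; have c0 : 0 <= c by have := Hu 0%N; rewrite expr0 mulr1; apply: le_trans.
have r0 n : 0 <= 2^-1 ^+ n :> R by rewrite exprn_ge0.
(* The exact partial sum of the geometric series, which is what the induction on m reproduces. *)
have tele n m : `|u (n + m)%N - u n| <= 2 * c * 2^-1 ^+ n * (1 - 2^-1 ^+ m).
  elim: m => [|m IH]; first by rewrite addn0 subrr normr0 expr0 subrr mulr0.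
  apply: (le_trans (ler_distD (u (n + m)%N) _ _)); rewrite addnS.
  apply: (le_trans (lerD (Hu (n + m)%N) IH)).
  by rewrite exprD exprS le_eqVlt; apply/orP; left; apply/eqP; field.
have tele2 n m : (n <= m)%N -> `|u m - u n| <= 2 * c * 2^-1 ^+ n.
  move=> nm; rewrite -(subnKC nm); apply: (le_trans (tele n _)).
  by rewrite ler_piMr ?mulr_ge0// lerBlDr lerDl.
have geo0 : (2 * c * 2^-1 ^+ n : R) @[n --> \oo] --> 0.
  rewrite -[X in _ --> X](mulr0 (2 * c)); apply: cvgM; first exact: cvg_cst.
  by apply: cvg_expr; rewrite ger0_norm ?invr_ge0// invf_lt1// ltr1n.
have cu : u n @[n --> \oo] --> lim (u n @[n --> \oo]).
  apply/cauchy_cvgP; apply: cauchy_exP => eps eps0.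
  move/cvgrPdist_lt/(_ _ eps0) : geo0 => [N _ HN]; exists (u N); exists N => // m /= Nm.
  rewrite -ball_normE/= distrC; apply: (le_lt_trans (tele2 _ _ Nm)).
  have := HN N (leqnn N); rewrite /= sub0r normrN; apply: le_lt_trans; exact: ler_norm.
split=> // n.
have cn : `|u m - u n| @[m --> \oo] --> `|lim (u n @[n --> \oo]) - u n|.
  by apply: cvg_norm; apply: cvgB => //; exact: cvg_cst.
rewrite -(cvg_lim _ cn)//; apply: limr_le; first by apply/cvg_ex; eexists; exact: cn.
by exists n => // m /= nm; exact: tele2.
Qed.

Section ApproximateSelections.
Context {R : realType} {E : completeNormedModType R} (T : R).
Local Notation mu := (@completed_lebesgue_measure R).
Local Notation I := (`[0, T]%classic : set R).
Hypothesis T_ge0 : 0 <= T.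
Variable e : nat -> E.
Hypothesis eP : forall x eps, 0 < eps -> exists j, `|x - e j| < eps.
Variable F : R -> E -> set E.
Hypothesis F_values : closed_bounded_values T F.
Hypothesis F_meas : forall x : E, Sigma_measurable T (F ^~ x).
Variables alpha beta : R -> R.
Let gamma t := 1 + `|alpha t| + `|beta t|.

Let good t := (forall x y, hausdorff_dist (F t x) (F t y) <= alpha t * `|x - y|) /\
  set_dist 0 (F t 0) <= beta t.

Hypothesis goodP : {ae mu, forall t, I t -> good t}.

Variable k : R -> R -> bounded_endo E.
Hypothesis k_meas : forall t, I t -> strongly_measurable `[0, t]%classic (k t).
Hypothesis gamma_meas : Lmfun I gamma.
Hypothesis k_gamma : forall t, I t ->
  (\int[mu]_(s in I) (`|kernel_ext k t s| * gamma s)%:E < +oo)%E.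
Hypothesis k_gamma_cvg : forall t, I t -> forall eps : R, 0 < eps ->
  \forall u \near t, I u ->
    (\int[mu]_(s in I) (`|kernel_ext k u s - kernel_ext k t s| * gamma s)%:E < eps%:E)%E.

Let mI : Lmeasurable I. Proof. exact: Lmeasurable_itv. Qed.
Let Ifin : (mu I < +oo)%E. Proof. exact: mu_segment_lty. Qed.

Let gamma_ge1 t : 1 <= gamma t.
Proof. by rewrite /gamma -addrA lerDl addr_ge0. Qed.

Let gamma_ge0 t : 0 <= gamma t. Proof. exact: le_trans (gamma_ge1 t). Qed.

Lemma I0_proof : (0 : R) \in I.
Proof. by rewrite inE/= in_itv/= lexx. Qed.

(** Curves have the subtype as domain whereas a.e. statements range over the real line; times
    outside I are sent to 0. *)
Definition time (t : R) : set_type I := insubd (SigSub I0_proof : set_type I) t.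

Lemma timeK t : I t -> \val (time t) = t.
Proof. by move=> It; rewrite insubdK// inE. Qed.

Lemma val_time (u : set_type I) : time (\val u) = u.
Proof. exact: valKd. Qed.

Lemma lipschitz_set_dist t z x y : I t -> good t ->
  set_dist z (F t y) <= set_dist z (F t x) + `|alpha t| * `|x - y|.
Proof.
move=> It [lip _]; have [Fx0 _ Fxb] := F_values x It; have [Fy0 _ _] := F_values y It.
rewrite (le_trans (set_dist_hausdorff z Fx0 Fy0 Fxb))// lerD2l.
by rewrite (le_trans (lip _ _))// ler_wpM2r// ler_norm.
Qed.

Definition label := CI T E -> R -> nat.

Implicit Types (nu : label) (h : CI T E).

Definition label_value nu h t : E := e (nu h t).

(* Labels may jump, but at each h and almost every t they are locally constant
   in h; this is what makes the associated curves depend continuously on h. *)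
Definition good_label nu := [/\ forall h, nat_measurable I (nu h),
  forall h, {ae mu, forall t, I t -> \forall h' \near h, nu h' t = nu h t} &
  forall h, exists2 C, 0 <= C & \forall h' \near h,
    {ae mu, forall t, I t -> `|label_value nu h' t| <= C * gamma t}].

Definition label_curve nu h : CI T E := h + kernel_CI T k (label_value nu h).

Lemma label_value_meas nu h : good_label nu -> strongly_measurable I (label_value nu h).
Proof.
move=> [mnu _ _]; apply: (strongly_measurable_dist eP) => // j.
exact: (nat_measurable_Lmfun (fun i => `|e i - e j|) (mnu h)).
Qed.

Lemma label_value_dominated nu h : good_label nu ->
  gamma_dominated T gamma (label_value nu h).
Proof.
move=> gnu; split; first exact: label_value_meas.
have [_ _ /(_ h)[C C0 HC]] := gnu; exists C => //.
exact: nbhs_singleton HC.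
Qed.

(** Along a convergent sequence the labels at almost every t are eventually constant, from a rank
    that may depend on t. This gives a.e. convergence of the densities, and [kernel_op_cvg] turns it
    into uniform convergence of the curves. *)
Lemma label_curve_continuous nu : good_label nu -> continuous (label_curve nu).
Proof.
move=> gnu.
suff H : continuous (fun h => kernel_CI T k (label_value nu h)).
  by move=> h; exact: (cvgD (@cvg_id _ (nbhs h)) (H h)).
apply: normed_seq_continuous => h u_ uh; have [mnu locnu /(_ h)[C C0 domnu]] := gnu.
(* The common bound C gamma holds only near h, so the sequence is shifted by N. *)
have [N _ HN] : \forall n \near \oo,
    {ae mu, forall t, I t -> `|label_value nu (u_ n) t| <= C * gamma t}.
  exact: uh domnu.
apply/cvgrPdist_le => eps eps0.
have [] := kernel_op_cvg k_meas gamma_meas gamma_ge1 k_gamma k_gamma_cvg C0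
  (label_value_meas h gnu) (fun m => label_value_meas (u_ (m + N)%N) gnu) _ _ _ eps0.
- exact: nbhs_singleton domnu.
- by move=> m; apply: HN; rewrite /= leq_addl.
- apply: Lae_imp (locnu h) => t H It.
  apply: (@cvg_near_cst _ _ _ _ _).
  have /= := uh _ (H It); rewrite nbhs_simpl/= => -[M _ HM].
  exists M => // m /= Mm; rewrite /label_value; congr e; apply: HM => /=.
  exact: leq_trans (leq_addr _ _).
move=> M HM; exists (M + N)%N => // n /= MNn.
have Nn : (N <= n)%N by exact: leq_trans (leq_addl _ _) MNn.
apply: maxnorm_le; first exact: ltW.
move=> t; rewrite -[n](subnK Nn) distrC.
have := HM (n - N)%N _ (\val t) (set_mem (valP t)).
rewrite leq_subRL// addnC => /(_ MNn).
rewrite -!(kernel_CIE k_meas gamma_meas gamma_ge1 k_gamma k_gamma_cvg)//;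
  exact: label_value_dominated.
Qed.

(** * One step: from a label to a better one *)

Section Step.
Variables (nu : label) (sigma : R).
Hypotheses (gnu : good_label nu) (sigma0 : 0 < sigma).
Local Notation x := (label_curve nu).

(** Normalised so that the threshold [eps * (1 + t)] does not exceed sigma on I. *)
Let eps := sigma / (1 + T).
Let T1 : 0 < 1 + T. Proof. by rewrite ltr_pwDl. Qed.
Let eps0 : 0 < eps. Proof. by rewrite divr_gt0. Qed.

Let center h t := first_nat (fun j => step_dist e j (x h) < eps * (1 + t)).

Let center_ex h t : I t -> exists j, step_dist e j (x h) < eps * (1 + t).
Proof.
rewrite /= in_itv/= => /andP[t0 _].
have e2 : 0 < eps / 2 by rewrite divr_gt0.
have [j Hj] := step_label_approx eP (x h) e2; exists j.
rewrite (le_lt_trans (step_dist_le T_ge0 Hj))//.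
by rewrite ltr_pM2l//; lra.
Qed.

Let cell h t := step_label (center h t) t.

Let cell_dist h t : I t -> `|x h (time t) - e (cell h t)| <= sigma.
Proof.
move=> It; have [+ _] := first_natP (center_ex h It); rewrite -/(center h t) => H.
have := step_dist_ub e (center h t) (x h) (time t).
rewrite timeK// => /le_trans; apply; apply: (le_trans (ltW H)).
rewrite /eps mulrAC ler_pdivrMr// ler_wpM2l ?(ltW sigma0)// lerD2l.
by move: It; rewrite /= in_itv/= => /andP[].
Qed.

(** A substitute for the projection of e_i onto F(t,e_l): e_j is nearly in that set, and nearly
    realises the distance from e_i to it. The curve enters only through the label l, so the test
    inherits measurability in t and local constancy in h. *)
Let admissible (i l : nat) t (j : nat) :=
  (set_dist (e j) (F t (e l)) < sigma) &&
  (`|e j - e i| < set_dist (e i) (F t (e l)) + sigma).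

Let admissible_ex i l t : I t -> exists j, admissible i l t j.
Proof.
move=> It; have [F0 _ _] := F_values (e l) It.
have s2 : 0 < sigma / 2 by rewrite divr_gt0.
have [|y Fy ey] := @set_dist_lt _ _ (e i) _ (set_dist (e i) (F t (e l)) + sigma / 2) F0.
  by rewrite ltrDl.
have [j yj] := eP y s2; exists j; apply/andP; split.
  rewrite (le_lt_trans (set_dist_le _ Fy))// distrC; lra.
rewrite (le_lt_trans (ler_distD y _ _))// distrC.
by rewrite [`|y - e i|]distrC; lra.
Qed.

Definition next_label : label :=
  fun h t => first_nat (admissible (nu h t) (cell h t) t).

Let next_admissible h t : I t ->
  admissible (nu h t) (cell h t) t (next_label h t).
Proof. by move=> It; have [] := first_natP (admissible_ex (nu h t) (cell h t) It). Qed.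

(** Admissibility costs sigma, and moving the base point from the step value to the curve costs
    |alpha| sigma; gamma absorbs both. *)
Lemma next_label_dist h t : I t -> good t ->
  set_dist (label_value next_label h t) (F t (x h (time t))) <= sigma * gamma t.
Proof.
move=> It gt; have /andP[H _] := next_admissible h It.
apply: (le_trans (lipschitz_set_dist _ (e (cell h t)) _ It gt)).
apply: (@le_trans _ _ (sigma + `|alpha t| * sigma)).
  by rewrite lerD ?(ltW H)// ler_wpM2l// distrC cell_dist.
rewrite /gamma mulrDr mulrDr mulr1 mulrC lerDl mulr_ge0//; exact: ltW.
Qed.

(** Filippov's estimate: the size of the correction is governed by how far the current value is from
    solving the inclusion. *)
Lemma next_label_step h t : I t -> good t ->
  `|label_value next_label h t - label_value nu h t| <=
  set_dist (label_value nu h t) (F t (x h (time t))) + sigma * gamma t.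
Proof.
move=> It gt; have /andP[_ H] := next_admissible h It.
apply: (le_trans (ltW H)).
apply: (@le_trans _ _ (set_dist (e (nu h t)) (F t (x h (time t))) +
   `|alpha t| * sigma + sigma)).
  rewrite lerD2r (le_trans (lipschitz_set_dist _ (x h (time t)) _ It gt))// lerD2l.
  by rewrite ler_wpM2l// cell_dist.
rewrite /gamma -addrA lerD2l mulrDr mulrDr mulr1 [sigma * `|alpha t|]mulrC.
by rewrite [_ + sigma]addrC lerDl mulr_ge0//; exact: ltW.
Qed.

Lemma next_label_meas h : nat_measurable I (next_label h).
Proof.
have mcenter : nat_measurable I (center h).
  apply: (nat_measurable_first mI (P := fun j t => step_dist e j (x h) < eps * (1 + t))).
    move=> j; apply: Lmfun_ltr => //; first exact: Lmfun_cst.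
    by apply: LmfunZ; apply: LmfunD; [exact: Lmfun_cst|exact: Lmfun_id].
  by move=> t; exact: center_ex.
have mcell : nat_measurable I (cell h).
  move=> l; apply: (nat_measurable_section (Q := fun j t => step_label j t = l) mcenter).
  by move=> j; exact: step_label_measurable.
have [mnu _ _] := gnu.
have mdist i l : Lmfun I (fun t => set_dist (e i) (F t (e l))).
  by apply: set_dist_measurable => // t It; have [] := F_values (e l) It.
apply: (nat_measurable_first mI
  (P := fun j t => admissible (nu h t) (cell h t) t j)); last first.
  by move=> t; exact: admissible_ex.
(* The current label and the cell label are frozen in turn; for constant i and l only distances to
   the measurable map F(.,e_l) remain. *)
move=> j; apply: (nat_measurable_section
  (Q := fun i t => admissible i (cell h t) t j) (mnu h)) => i.
apply: (nat_measurable_section (Q := fun l t => admissible i l t j) mcell) => l.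
rewrite (_ : _ `&` _ =
  (I `&` [set t | set_dist (e j) (F t (e l)) < sigma]) `&`
  (I `&` [set t | `|e j - e i| < set_dist (e i) (F t (e l)) + sigma])).
  apply: LmeasurableI; (apply: Lmfun_ltr; first exact: mI).
  - exact: mdist.
  - exact: Lmfun_cst.
  - exact: Lmfun_cst.
  - by apply: LmfunD; [exact: mdist|exact: Lmfun_cst].
by apply/seteqP; split=> [t [It /andP[]]|t [[It /= H1] [_ /= H2]]] //=;
  split=> //; apply/andP.
Qed.

Lemma next_label_near h :
  {ae mu, forall t, I t -> \forall h' \near h, next_label h' t = next_label h t}.
Proof.
have [_ locnu _] := gnu.
(* The excluded value is the unique t at which the j-th distance equals [eps * (1 + t)]; elsewhere
   the strict comparison is stable in h. *)
have off : {ae mu, forall t, forall j, t <> step_dist e j (x h) / eps - 1}.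
  by apply: Lae_foralln => j; exact: Lae_neq.
apply: Lae_imp2 (locnu h) off => t H nt It.
have cen : \forall h' \near h, center h' t = center h t.
  apply: (@first_nat_near _ (nbhs h) _
    (fun h' => fun j => step_dist e j (x h') < eps * (1 + t))
    (fun j => step_dist e j (x h) < eps * (1 + t))); last exact: center_ex.
  move=> j; apply: (@step_dist_near _ _ _ T_ge0 _ _ x j h _ (@label_curve_continuous nu gnu h)).
  move=> dE; apply: (nt j); rewrite dE mulrAC mulfV ?gt_eqF// mul1r.
  by rewrite addrC addKr.
move: (H It) cen; apply: filterS2 => h' Hh' Hc.
by rewrite /next_label /cell Hh' Hc.
Qed.

Lemma next_label_dominated h : exists2 C, 0 <= C & \forall h' \near h,
  {ae mu, forall t, I t -> `|label_value next_label h' t| <= C * gamma t}.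
Proof.
have [_ _ /(_ h)[C C0 domnu]] := gnu.
(* Twice the old bound (old value, and its part in the correction), 1 for d(0,F(t,0)), the norm of
   the nearby curves multiplied by alpha, and sigma for the tolerance. *)
exists (2 * C + 1 + (`|x h| + 1) + sigma).
  by rewrite !addr_ge0 ?mulr_ge0// ltW.
have xh : \forall h' \near h, `|x h'| <= `|x h| + 1.
  have /cvgrPdist_lt/(_ _ ltr01) := @label_curve_continuous nu gnu h.
  apply: filterS => h' /ltW Hh'; apply: (le_trans (ler_norm_dist (x h) (x h'))).
  by rewrite lerD2l.
suff key h' : {ae mu, forall t, I t -> `|label_value nu h' t| <= C * gamma t} ->
    `|x h'| <= `|x h| + 1 ->
    {ae mu, forall t, I t -> `|label_value next_label h' t| <=
                              (2 * C + 1 + (`|x h| + 1) + sigma) * gamma t}.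
  by apply: filterS2 domnu xh => h'; exact: key.
move=> domh' xh'; apply: Lae_imp2 domh' goodP => t H G It.
have {}H := H It; have {}G := G It; have step := next_label_step h' It G.
have [F0 _ _] := F_values (x h' (time t)) It.
have d1 := set_dist_lip (label_value nu h' t) 0 F0.
have d2 := lipschitz_set_dist 0 0 (x h' (time t)) It G.
have b : set_dist 0 (F t 0) <= `|beta t| by rewrite (le_trans G.2)// ler_norm.
have xt : `|x h' (time t)| <= `|x h| + 1.
  by rewrite (le_trans _ xh')//; exact: maxnorm_ub.
rewrite subr0 in d1; rewrite sub0r normrN in d2.
have a : `|alpha t| * `|x h' (time t)| <= gamma t * (`|x h| + 1).
  apply: ler_pM => //; rewrite /gamma -addrA addrCA lerDl addr_ge0//.
have bg : `|beta t| <= gamma t by rewrite /gamma addrC lerDl addr_ge0.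
apply: (le_trans (ler_norm_dist (label_value nu h' t) _)); rewrite distrC.
exact: (domination_arith H step d1 d2 a (le_trans b bg)).
Qed.

Lemma next_label_good : good_label next_label.
Proof.
by split; [exact: next_label_meas|exact: next_label_near|exact: next_label_dominated].
Qed.

End Step.

(** * Geometric iteration and passage to the limit *)

Section Iteration.
Variable lam : R.
Hypothesis lam_ge0 : 0 <= lam.
Hypothesis lamP : forall t, I t ->
  (\int[mu]_(s in I) (`|kernel_ext k t s| * (gamma s * expR (lam * s)))%:E <=
   (4^-1 * expR (lam * t))%:E)%E.

(** A density error c W gives a curve error (c / 4) e^(lam t), and multiplication by |alpha| <=
    gamma brings it back to (c / 4) W: this closes the recursion. *)
Let W s := gamma s * expR (lam * s).

Let W_meas : Lmfun I W.
Proof.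
apply: LmfunM => //; apply: (@Lmfun_comp _ _ (fun s => lam * s) expR).
  exact: measurable_expR.
by apply: LmfunZ; exact: Lmfun_id.
Qed.

Let W_ge0 s : 0 <= W s. Proof. by rewrite mulr_ge0// expR_ge0. Qed.

Let exp_ge1 s : I s -> 1 <= expR (lam * s).
Proof.
rewrite /= in_itv/= => /andP[s0 _].
by apply: le_trans (expR_ge1Dx _); rewrite lerDl mulr_ge0.
Qed.

Let gamma_le_W s : I s -> gamma s <= W s.
Proof. by move=> Is; rewrite ler_peMr// exp_ge1. Qed.

Let alpha_le_gamma s : `|alpha s| <= gamma s.
Proof. by rewrite /gamma -addrA addrCA lerDl addr_ge0. Qed.

Let beta_le_gamma s : `|beta s| <= gamma s.
Proof. by rewrite /gamma addrC lerDl addr_ge0. Qed.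

Lemma kernel_CI_dist (v w : R -> E) c (h : CI T E) u :
  gamma_dominated T gamma v -> gamma_dominated T gamma w -> 0 <= c ->
  {ae mu, forall s, I s -> `|v s - w s| <= c * W s} ->
  `|(h + kernel_CI T k v) u - (h + kernel_CI T k w) u| <=
    c / 4 * expR (lam * \val u).
Proof.
move=> dv dw c0 vw; have Iu : I (\val u) by exact: set_mem (valP u).
have -> : (h + kernel_CI T k v) u - (h + kernel_CI T k w) u =
    kernel_op k v (\val u) - kernel_op k w (\val u).
  rewrite -!(kernel_CIE k_meas gamma_meas gamma_ge1 k_gamma k_gamma_cvg)//.
  have sub (a b d : E) : a + b - (a + d) = b - d by rewrite opprD addrACA subrr add0r.
  exact: sub.
have mkt : Lmfun I (fun s => `|kernel_ext k (\val u) s|).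
  by apply: strongly_measurable_norm; exact: kernel_ext_meas.
rewrite -lee_fin (le_trans (kernel_op_le k_meas gamma_meas gamma_ge1 k_gamma Iu dv dw
  (LmfunZ c W_meas) (fun s => mulr_ge0 c0 (W_ge0 s)) vw))//.
rewrite (_ : (\int[mu]_(s in I) _)%E =
  (\int[mu]_(s in I) (c * (`|kernel_ext k (\val u) s| * W s))%:E)%E); last first.
  by apply: eq_integral => s _; rewrite mulrCA.
rewrite LintegralZ//; last 2 first.
- exact: LmfunM.
- by move=> s; rewrite mulr_ge0.
by rewrite -mulrA EFinM lee_wpmul2l ?lee_fin//; exact: lamP.
Qed.

Lemma label_curve_dist nu nu' c h t : good_label nu -> good_label nu' -> 0 <= c ->
  {ae mu, forall s, I s -> `|label_value nu h s - label_value nu' h s| <= c * W s} ->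
  I t -> `|label_curve nu h (time t) - label_curve nu' h (time t)| <=
    c / 4 * expR (lam * t).
Proof.
move=> gnu gnu' c0 vv' It; rewrite -[t in expR (lam * t)](timeK It).
apply: kernel_CI_dist => //; exact: label_value_dominated.
Qed.

(** The tolerances decay at the rate 1/2 of the iterates, so that they can be absorbed at every
    step. *)
Let sig n : R := 2^-1 ^+ n / 4.

Let sig_gt0 n : 0 < sig n. Proof. by rewrite divr_gt0// exprn_gt0. Qed.

Fixpoint iter_label n : label :=
  if n is m.+1 then next_label (iter_label m) (sig m) else fun _ _ => 0%N.

Lemma iter_label_good n : good_label (iter_label n).
Proof.
elim: n => [|n IH]; last exact: next_label_good.
split=> h; first exact: (nat_measurable_cst mI 0%N).
  by apply: LaeW => t _; apply: filterE.
exists `|e 0%N| => //; apply: filterE => h'.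
apply: (@LaeW _ (fun t => I t -> _)) => t _.
exact: (ler_peMr (normr_ge0 (e 0%N)) (gamma_ge1 t)).
Qed.

Local Notation v n := (label_value (iter_label n)).
Local Notation x n := (label_curve (iter_label n)).

Let v_dominated n h : gamma_dominated T gamma (v n h).
Proof. by apply: label_value_dominated; exact: iter_label_good. Qed.

(** Bounds the first correction relative to gamma; in the summand 2, one unit covers d(0,F(t,0)) and
    one the initial tolerance. It depends continuously on h through the first curve, whence the
    local uniformity. *)
Let B h : R := `|e 0%N| + `|x 0%N h| + 2.

Let B_ge2 h : 2 <= B h. Proof. by rewrite lerDr addr_ge0. Qed.

Lemma iter_label_step0 h :
  {ae mu, forall t, I t -> `|v 1%N h t - v 0%N h t| <= B h * gamma t}.
Proof.
apply: Lae_imp goodP => t G It; have {}G := G It.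
apply: (le_trans (next_label_step _ (sig_gt0 0) h It G)).
have [F0 _ _] := F_values (x 0%N h (time t)) It.
have := set_dist_lip (v 0%N h t) 0 F0; rewrite subr0 {1}/label_value/= => d1.
have := lipschitz_set_dist 0 0 (x 0%N h (time t)) It G; rewrite sub0r normrN => d2.
have b : set_dist 0 (F t 0) <= gamma t.
  by rewrite (le_trans G.2)// (le_trans (ler_norm _)).
have a : `|alpha t| * `|x 0%N h (time t)| <= gamma t * `|x 0%N h|.
  by apply: ler_pM => //; exact: maxnorm_ub.
have s0 : sig 0 * gamma t <= gamma t.
  by rewrite ler_piMl// /sig expr0 mul1r invf_le1// ler1n.
have e0 : `|e 0%N| <= `|e 0%N| * gamma t.
  exact: (ler_peMr (normr_ge0 (e 0%N)) (gamma_ge1 t)).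
apply: (le_trans (lerD (le_trans d1 (lerD e0 (le_trans d2 (lerD b a)))) s0)).
by rewrite le_eqVlt; apply/orP; left; apply/eqP; rewrite /B; ring.
Qed.

(** By induction the curves n and n+1 differ by at most B 2^-n e^(lam t), the factor 4 being
    cancelled by the 1/4 of the weight. So v_(n+1), almost in F(t,x_n(t)), is within B 2^-n W plus a
    tolerance of F(t,x_(n+1)(t)). The two tolerances add (1/4 + 1/8) 2^-n gamma, and since B >= 2
    the total is at most 2 B 2^-n W = 4 B 2^-(n+1) W. *)
Lemma iter_label_step n h : {ae mu, forall t, I t ->
  `|v n.+1 h t - v n h t| <= 4 * B h * 2^-1 ^+ n * W t}.
Proof.
have B0 : 0 <= B h by exact: le_trans (B_ge2 h).
elim: n => [|n IH].
  apply: Lae_imp (iter_label_step0 h) => t H It; apply: (le_trans (H It)).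
  rewrite expr0 mulr1 ler_pM//; last exact: gamma_le_W.
  by rewrite ler_peMl// ler1n.
have r0 : 0 <= 2^-1 ^+ n :> R by rewrite exprn_ge0.
have c0 : 0 <= 4 * B h * 2^-1 ^+ n by rewrite !mulr_ge0.
have dx t : I t -> `|x n h (time t) - x n.+1 h (time t)| <=
    B h * 2^-1 ^+ n * expR (lam * t).
  move=> It; rewrite distrC.
  apply: (le_trans (label_curve_dist (iter_label_good n.+1) (iter_label_good n) c0 IH It)).
  by rewrite le_eqVlt; apply/orP; left; apply/eqP; field.
apply: Lae_imp goodP => t G It; have {}G := G It.
apply: (le_trans (next_label_step _ (sig_gt0 n.+1) h It G)).
have d1 := lipschitz_set_dist (v n.+1 h t) (x n h (time t)) (x n.+1 h (time t)) It G.
have d2 := next_label_dist (iter_label n) (sig_gt0 n) h It G.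
have d3 : `|alpha t| * `|x n h (time t) - x n.+1 h (time t)| <=
    B h * (2^-1 ^+ n * W t).
  apply: (@le_trans _ _ (gamma t * (B h * 2^-1 ^+ n * expR (lam * t)))).
    by apply: ler_pM => //; exact: dx.
  by rewrite le_eqVlt; apply/orP; left; apply/eqP; rewrite /W; ring.
have gW : 2^-1 ^+ n * gamma t <= 2^-1 ^+ n * W t by rewrite ler_wpM2l// gamma_le_W.
have rW : 0 <= 2^-1 ^+ n * W t by rewrite mulr_ge0.
have BW : 2 * (2^-1 ^+ n * W t) <= B h * (2^-1 ^+ n * W t) by rewrite ler_wpM2r.
apply: (le_trans (lerD (le_trans d1 (lerD d2 d3)) (lexx _))).
have -> : sig n * gamma t = 4^-1 * (2^-1 ^+ n * gamma t) by rewrite /sig; ring.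
have -> : sig n.+1 * gamma t = 8^-1 * (2^-1 ^+ n * gamma t).
  by rewrite /sig exprS; field.
have -> : 4 * B h * 2^-1 ^+ n.+1 * W t = 2 * (B h * (2^-1 ^+ n * W t)).
  by rewrite exprS; field.
exact: step_arith gW rW BW.
Qed.

Definition limit_density h t : E := lim (v n h t @[n --> \oo]).

Lemma limit_densityP h : {ae mu, forall t, I t ->
  v n h t @[n --> \oo] --> limit_density h t /\
  forall n, `|limit_density h t - v n h t| <= 8 * B h * 2^-1 ^+ n * W t}.
Proof.
apply: Lae_imp (Lae_foralln (fun n => iter_label_step n h)) => t H It.
have [|cv dv] := @geometric_cvg _ _ (fun n => v n h t) (4 * B h * W t).
  by move=> n; rewrite mulrAC; exact: H.
split=> // n; apply: (le_trans (dv n)).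
by rewrite le_eqVlt; apply/orP; left; apply/eqP; ring.
Qed.

Lemma limit_density_dominated h : gamma_dominated T gamma (limit_density h).
Proof.
have B0 : 0 <= B h by exact: le_trans (B_ge2 h).
split.
  apply: (strongly_measurable_dist eP) => // j.
  apply: (@Lmfun_ae_cvg _ _ (fun n t => `|v n h t - e j|)) => //.
    move=> n; apply: (nat_measurable_Lmfun (fun i => `|e i - e j|)).
    by have [+ _ _] := iter_label_good n; apply.
  apply: Lae_imp (limit_densityP h) => t H It; apply: cvg_norm.
  by apply: cvgB; [exact: (H It).1|exact: cvg_cst].
exists (`|e 0%N| + 8 * B h * expR (lam * T)).
  by rewrite addr_ge0// !mulr_ge0// expR_ge0.
apply: Lae_imp (limit_densityP h) => t H It; have {H} := (H It).2 0%N.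
rewrite expr0 mulr1 distrC => H.
apply: (le_trans (ler_norm_dist (v 0%N h t) _)); rewrite mulrDl lerD//.
  exact: (ler_peMr (normr_ge0 (e 0%N)) (gamma_ge1 t)).
apply: (le_trans H); rewrite /W [gamma t * _]mulrC mulrA ler_wpM2r//.
rewrite ler_wpM2l ?mulr_ge0// ler_expR ler_wpM2l//.
by move: It; rewrite /= in_itv/= => /andP[].
Qed.

Definition limit_curve h : CI T E := h + kernel_CI T k (limit_density h).

Lemma limit_curve_dist n h u : `|limit_curve h u - x n h u| <=
  2 * B h * expR (lam * T) * 2^-1 ^+ n.
Proof.
have B0 : 0 <= B h by exact: le_trans (B_ge2 h).
have r0 : 0 <= 2^-1 ^+ n :> R by rewrite exprn_ge0.
have c0 : 0 <= 8 * B h * 2^-1 ^+ n by rewrite !mulr_ge0.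
apply: (le_trans (kernel_CI_dist h u (limit_density_dominated h) (v_dominated n h) c0 _)).
  by apply: Lae_imp (limit_densityP h) => t H It; exact: (H It).2.
have uT : expR (lam * \val u) <= expR (lam * T).
  rewrite ler_expR ler_wpM2l//.
  by have := set_mem (valP u); rewrite /= in_itv/= => /andP[].
have -> : 8 * B h * 2^-1 ^+ n / 4 = 2 * B h * 2^-1 ^+ n by field.
by rewrite [leRHS]mulrAC ler_wpM2l// !mulr_ge0.
Qed.

(** A locally uniform limit of continuous maps: near h the bound [B] exceeds its value at h by at
    most 1, so one index n serves all nearby h'. *)
Lemma limit_curve_continuous : continuous limit_curve.
Proof.
apply: normed_continuousP => h eps eps0.
pose M := 2 * (B h + 1) * expR (lam * T).
have B0 h' : 0 <= B h' by exact: le_trans (B_ge2 h').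
have M0 : 0 < M by rewrite !mulr_gt0 ?expR_gt0// ltr_wpDl.
have [n Hn] : exists n, M * 2^-1 ^+ n <= eps / 3.
  have : (M * 2^-1 ^+ n : R) @[n --> \oo] --> 0.
    rewrite -[X in _ --> X](mulr0 M); apply: cvgM; first exact: cvg_cst.
    by apply: cvg_expr; rewrite ger0_norm ?invr_ge0// invf_lt1// ltr1n.
  have e3 : 0 < eps / 3 by rewrite divr_gt0.
  move=> /cvgrPdist_le/(_ _ e3)[n _ Hn]; exists n; have := Hn n (leqnn n).
  by rewrite /= sub0r normrN; apply: le_trans; exact: ler_norm.
have cx m := @label_curve_continuous _ (iter_label_good m) h.
have near0 : \forall h' \near h, B h' <= B h + 1.
  have /cvgrPdist_le/(_ _ ltr01) := cx 0%N.
  apply: filterS => h' Hh'.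
  exact: (shift_arith _ (ler_norm_dist (x 0%N h) (x 0%N h')) Hh').
have near1 : \forall h' \near h, `|x n h - x n h'| <= eps / 3.
  have e3 : 0 < eps / 3 by rewrite divr_gt0.
  by have /cvgrPdist_le/(_ _ e3) := cx n.
have H (h' : CI T E) : B h' <= B h + 1 -> forall u, `|limit_curve h' u - x n h' u| <= eps / 3.
  move=> Bh' u; apply: (le_trans (limit_curve_dist n h' u)); apply: le_trans Hn.
  by rewrite ler_wpM2r ?exprn_ge0// /M ler_wpM2r ?expR_ge0// ler_wpM2l.
apply: filterS2 near0 near1 => h' B1 x1.
apply: maxnorm_le; first exact: ltW.
move=> u; have d1 := H h' B1 u.
have d2 : `|limit_curve h u - x n h u| <= eps / 3 by apply: H; rewrite lerDl.
have d3 : `|x n h u - x n h' u| <= eps / 3.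
  by apply: le_trans x1; exact: (maxnorm_ub (x n h - x n h') u).
exact: (dist_thirds d2 d3 d1).
Qed.

(** The value v_(n+1)(t) is close both to the limit density and to F(t,x_n(t)), and the latter is
    close to F at the limit curve. All errors are O(2^-n) at fixed t, so closedness of the values
    concludes. *)
Lemma limit_density_selection h : {ae mu, forall t, I t ->
  F t (limit_curve h (time t)) (limit_density h t)}.
Proof.
have B0 : 0 <= B h by exact: le_trans (B_ge2 h).
apply: Lae_imp2 (limit_densityP h) goodP => t H G It.
have {H} [_ H] := H It; have {}G := G It.
have [F0 Fc _] := F_values (limit_curve h (time t)) It.
apply: set_dist_closed => // eps eps0.
pose M := 8 * B h * W t + gamma t + gamma t * (2 * B h * expR (lam * T)).
have bound n : set_dist (limit_density h t) (F t (limit_curve h (time t))) <=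
    M * 2^-1 ^+ n.
  have r0 : 0 <= 2^-1 ^+ n :> R by rewrite exprn_ge0.
  have d1 := set_dist_lip (limit_density h t) (v n.+1 h t) F0.
  have d2 := lipschitz_set_dist (v n.+1 h t) (x n h (time t)) (limit_curve h (time t)) It G.
  have d3 := next_label_dist (iter_label n) (sig_gt0 n) h It G.
  have d4 : `|alpha t| * `|x n h (time t) - limit_curve h (time t)| <=
      gamma t * (2 * B h * expR (lam * T) * 2^-1 ^+ n).
    by apply: ler_pM => //; rewrite distrC; exact: limit_curve_dist.
  have d5 : `|limit_density h t - v n.+1 h t| <= 8 * B h * W t * 2^-1 ^+ n.
    exact: (le_trans (H n.+1) (halving_arith n B0 (W_ge0 t))).
  have d6 : sig n * gamma t <= gamma t * 2^-1 ^+ n by exact: quarter_arith.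
  exact: (le_trans d1 (selection_arith d5 d2 (le_trans d3 d6) d4)).
have cM : (M * 2^-1 ^+ n : R) @[n --> \oo] --> 0.
  rewrite -[X in _ --> X](mulr0 M); apply: cvgM; first exact: cvg_cst.
  by apply: cvg_expr; rewrite ger0_norm ?invr_ge0// invf_lt1// ltr1n.
move/cvgrPdist_le/(_ _ eps0) : cM => [n _ Hn].
apply: (le_trans (bound n)); have := Hn n (leqnn n).
by rewrite /= sub0r normrN; apply: le_trans; exact: ler_norm.
Qed.

End Iteration.

Theorem continuous_solution_operator : exists f : CI T E -> CI T E, continuous f /\
  forall h, exists w : R -> E, [/\ gamma_dominated T gamma w,
    {ae mu, forall t, I t -> F t (f h (time t)) (w t)} &
    f h = h + kernel_CI T k w].
Proof.
have [lam lam0 lamP] := kernel_exp_weight k_meas gamma_meas gamma_ge1 k_gamma k_gamma_cvg.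
exists limit_curve; split; first exact: limit_curve_continuous lam0 lamP.
move=> h; exists (limit_density h); split => //.
- exact: limit_density_dominated lam0 lamP _.
- exact: limit_density_selection lam0 lamP _.
Qed.

End ApproximateSelections.

(** * The continuous selection of the solution map *)

Theorem theorem5 (R : realType) (T : R) (T_ge0 : 0 <= T)
    (p : R) (q : \bar R)
    (p_ge1 : 1 <= p) (q_gt1 : (1 < q)%E)
    (pq_conj : ((p^-1)%:E + q^-1 = 1)%E)
    (E : completeNormedModType R) (sepE : separable E)
    (F : R -> E -> set E)
    (H1 : closed_bounded_values T F)
    (H2 : forall x : E, Sigma_measurable T (F ^~ x))
    (H3 : hausdorff_lipschitz T p F)
    (H4 : dist0_bounded T p F)
    (k : R -> R -> bounded_endo E)
    (k5 : kernel_Lq T q k)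
    (k6 : kernel_continuous T q k) :
  exists f : CI T E -> CI T E,
    continuous f /\ forall h : CI T E, solution_set p F k h (f h).
Proof.
have [alpha aLp lip] := H3; have [beta bLp d0] := H4.
have [e eP] := separable_dense_seq sepE.
have Ifin := mu_segment_lty (0 : R) T.
have gLp := Lp_norm_sum3 p_ge1 Ifin aLp bLp.
have g0 t : 0 <= 1 + `|alpha t| + `|beta t| by rewrite !addr_ge0.
have g1 t : 1 <= 1 + `|alpha t| + `|beta t| by rewrite -addrA lerDl addr_ge0.
have mg : Lmfun `[0, T]%classic (fun t => 1 + `|alpha t| + `|beta t|).
  apply: LmfunD; last exact: strongly_measurable_norm bLp.1.
  by apply: LmfunD; [exact: Lmfun_cst|exact: strongly_measurable_norm aLp.1].
have k_meas t : `[0, T]%classic t -> strongly_measurable `[0, t]%classic (k t).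
  by move=> /k5[].
have good := Lae_imp2 (fun t P Q (It : `[0, T]%classic t) => conj (P It) (Q It)) lip d0.
have kg := kernel_ext_integral_lty p_ge1 q_gt1 pq_conj k5 gLp g0.
have kgc := kernel_ext_integral_cvg p_ge1 q_gt1 pq_conj k5 k6 gLp g0.
have [f [cf Hf]] :=
  continuous_solution_operator T_ge0 eP H1 H2 good k_meas mg kg kgc.
exists f; split => // h; have [w [dw selw fw]] := Hf h; exists w; split.
(* The density is dominated by a multiple of gamma, which belongs to L^p. *)
- have [mw [C C0 wC]] := dw; split => //.
  apply: (Lp_norm_dominated p_ge1 mw gLp.1 C0 _ gLp.2).
  by apply: Lae_imp wC => t H It; rewrite [`|1 + _ + _|]ger0_norm//; exact: H.
- apply: Lae_imp selw => s H t ts; rewrite -(val_time T_ge0 t) ts; apply: H.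
  by rewrite -ts; exact: set_mem (valP t).
- move=> t; rewrite {1}fw.
  transitivity (h t + kernel_CI T k w t) => //.
  by rewrite (kernel_CIE k_meas mg g1 kg kgc).
Qed.
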